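(* Let $\Gamma$ be an $n$-dimensional crystallographic group whose holonomy group is isomorphic to the cyclic group $C_m=\langle g\mid g^m=1\rangle$ of order $m$, where $m\geq 3$. (i) If $m$ is divisible by a prime larger than $3$, then $d(\Gamma)\leq n-2$. (ii) If $m$ is not divisible by any prime larger than $3$ and $\Gamma$ is torsion-free, then $d(\Gamma)\leq n-1$.
   Context: An $n$-dimensional crystallographic group is a discrete subgroup $\Gamma$ of $\mathbb{R}^n\rtimes O(n)$ (the group of isometries of $\mathbb{R}^n$) acting cocompactly on $\mathbb{R}^n$. Its translation subgroup $\Gamma\cap(\mathbb{R}^n\times I)$ is isomorphic to $\mathbb{Z}^n$, and the finite quotient $G=\Gamma/(\Gamma\cap(\mathbb{R}^n\times I))$ is called the holonomy group of $\Gamma$. Equivalently, $\Gamma$ is an $n$-dimensional crystallographic group with holonomy group $G$ if it fits in a short exact sequence $0\to\mathbb{Z}^n\to\Gamma\to G\to 1$ with $G$ finite such that the representation $\rho:G\to GL_n(\mathbb{Z})$ induced by conjugation is faithful. For a group $H$, $d(H)$ denotes the minimal number of generators of $H$. *)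

(* Defs.v *)
From HB Require Import structures.
From mathcomp Require Import all_boot all_order all_algebra all_fingroup.
From mathcomp Require Import all_classical all_reals all_analysis.

Set Implicit Arguments.
Unset Strict Implicit.
Unset Printing Implicit Defensive.

Import Order.TTheory GRing.Theory Num.Theory.
Import numFieldNormedType.Exports.
Local Open Scope classical_set_scope.

Section Groups.
Local Open Scope group_scope.
Variable G : groupType.
Implicit Types (H N A B : set G).

Definition is_subgroup H : Prop :=
  [/\ H 1, forall x y, H x -> H y -> H (x * y) & forall x, H x -> H x^-1].

Definition gen_subgroup A : set G := smallest is_subgroup A.

Definition generated_by H (k : nat) : Prop :=
  exists s : k.-tuple G, gen_subgroup [set` s] = H.

(* d(H) = d; no d satisfies this when H is not finitely generated. *)
Definition min_num_gens H (d : nat) : Prop :=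
  generated_by H d /\ forall k, generated_by H k -> (d <= k)%N.

Definition torsion_free H : Prop :=
  forall x k, H x -> (0 < k)%N -> x ^+ k = 1 -> x = 1.

Definition prod_set A B : set G := [set x * y | x in A & y in B].

(* The quotient H / N, as the set of the cosets x N with x in H; its group law
   is prod_set. *)
Definition cosets H N : set (set G) := [set prod_set [set x] N | x in H].

Definition quotient_isom H N (K : groupType) : Prop :=
  exists f : K -> set G,
    [/\ injective f, range f = cosets H N
      & forall a b, f (a * b) = prod_set (f a) (f b)].

End Groups.

Section Isometries.
Local Open Scope ring_scope.
Variables (R : realType) (n : nat).

(* The group R^n x| O(n): (v, A) is the isometry x |-> A x + v. *)
Definition is_eisometry (p : 'cV[R]_n * 'M[R]_n) : bool :=
  p.2^T *m p.2 == 1%:M.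

Record eisometry := EIsometry
  { eisometry_val :> 'cV[R]_n * 'M[R]_n; _ : is_eisometry eisometry_val }.

HB.instance Definition _ := [isSub for eisometry_val].
HB.instance Definition _ := [Choice of eisometry by <:].
HB.instance Definition _ :=
  Topological.copy eisometry (initial_topology eisometry_val).

Definition transl (g : eisometry) : 'cV[R]_n := (val g).1.
Definition linpart (g : eisometry) : 'M[R]_n := (val g).2.

Definition iact (g : eisometry) (x : 'cV[R]_n) : 'cV[R]_n :=
  linpart g *m x + transl g.

Lemma linpartP (g : eisometry) : (linpart g)^T *m linpart g = 1%:M.
Proof. exact: (eqP (valP g)). Qed.

Fact one_subproof : is_eisometry (0, 1%:M).
Proof. by rewrite /is_eisometry /= trmx1 mulmx1. Qed.

Fact mul_subproof (g h : eisometry) :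
  is_eisometry (transl g + linpart g *m transl h, linpart g *m linpart h).
Proof.
apply/eqP => /=.
by rewrite trmx_mul mulmxA -(mulmxA _ _ (linpart g)) linpartP mulmx1 linpartP.
Qed.

Fact inv_subproof (g : eisometry) :
  is_eisometry (- ((linpart g)^T *m transl g), (linpart g)^T).
Proof. by apply/eqP; rewrite /= trmxK; exact: mulmx1C (linpartP g). Qed.

Definition eisometry_one : eisometry := EIsometry one_subproof.
Definition eisometry_mul (g h : eisometry) : eisometry :=
  EIsometry (mul_subproof g h).
Definition eisometry_inv (g : eisometry) : eisometry :=
  EIsometry (inv_subproof g).

Fact eisometry_mulA : associative eisometry_mul.
Proof.
move=> f g h; apply/val_inj; rewrite /= /transl /linpart /=.
by rewrite mulmxDr !mulmxA addrA.
Qed.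

Fact eisometry_mul1 : left_id eisometry_one eisometry_mul.
Proof.
by case=> -[v A] i; apply/val_inj; rewrite /= /transl /linpart /= !mul1mx add0r.
Qed.

Fact eisometry_1mul : right_id eisometry_one eisometry_mul.
Proof.
by case=> -[v A] i; apply/val_inj;
  rewrite /= /transl /linpart /= mulmx0 mulmx1 addr0.
Qed.

Fact eisometry_mulV : left_inverse eisometry_one eisometry_inv eisometry_mul.
Proof.
move=> g; apply/val_inj; rewrite /=.
by rewrite -[linpart (eisometry_inv g)]/((linpart g)^T)
  -[transl (eisometry_inv g)]/(- ((linpart g)^T *m transl g)) addNr linpartP.
Qed.

Fact eisometry_Vmul : right_inverse eisometry_one eisometry_inv eisometry_mul.
Proof.
move=> g; apply/val_inj; rewrite /=.
have gV := mulmx1C (linpartP g).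
by rewrite -[linpart (eisometry_inv g)]/((linpart g)^T) gV
  -[transl (eisometry_inv g)]/(- ((linpart g)^T *m transl g))
  mulmxN mulmxA gV mul1mx subrr.
Qed.

HB.instance Definition _ := isGroup.Build eisometry
  eisometry_mulA eisometry_mul1 eisometry_1mul eisometry_mulV eisometry_Vmul.

Lemma iact1 x : iact 1%g x = x.
Proof. by rewrite /iact mul1mx addr0. Qed.

Lemma iactM g h x : iact (g * h)%g x = iact g (iact h x).
Proof.
rewrite /iact -[linpart (g * h)%g]/(linpart g *m linpart h).
rewrite -[transl (g * h)%g]/(transl g + linpart g *m transl h).
by rewrite mulmxDr mulmxA [transl g + _]addrC addrA.
Qed.

Definition discrete (Gamma : set eisometry) : Prop :=
  Gamma `<=` isolated Gamma.

(* As R^n is locally compact, the orbit space is compact if and only if some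
   compact set meets all the orbits. *)
Definition cocompact (Gamma : set eisometry) : Prop :=
  exists K : set 'cV[R]_n, compact K /\
    \bigcup_(g in Gamma) (iact g @` K) = setT.

Definition crystallographic (Gamma : set eisometry) : Prop :=
  [/\ is_subgroup Gamma, discrete Gamma & cocompact Gamma].

Definition translations (Gamma : set eisometry) : set eisometry :=
  Gamma `&` [set g | linpart g = 1%:M].

(* 'Z_m is only the cyclic group of order m when 1 < m; seen as a groupType,
   its law is addition. *)
Definition holonomy_cyclic (Gamma : set eisometry) (m : nat) : Prop :=
  quotient_isom Gamma (translations Gamma) 'Z_m.

End Isometries.

(* Main.v *)
(** The translation lattice [L] of [Gamma] has rank [n], and [Gamma] is generated
    by a lift [a] of a generator of the holonomy together with generators of [L] as
    a module over [Z[A]], [A] being the linear part of [a]; the element [a ^ m] of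
    [L] comes for free.  So it suffices to find few module generators of [L], and a
    power [B] of [A] of order [p >= 5], [3] or [4] is enough for this.

    The tool is the geometry of numbers.  Let [Phi] be the cyclotomic polynomial of
    the order of [B], [N] the kernel of [Phi(B)] in [L] and [v] a shortest nonzero
    vector of [N].  Rounding coordinates at random moves a combination of [k] vectors
    of the length of [v] within distance [sqrt k / 2 * |v|] of a combination with
    integer coordinates: up to three independent shortest vectors therefore span a
    pure sublattice, and so do four of them when two of these are not orthogonal.
    Pure families extend to bases of [L].

    For [p >= 5] the relation [v + B v + ... + B ^ (p - 1) v = 0] forbids [v] to be
    orthogonal to all the [B ^ i v]; with [C = B ^ i] for a suitable [i], the vectors
    [v, C v, C ^ 2 v, C ^ 3 v] start a basis of [L], and [v] generates them all.

    For order 3 or 4, [v, B v] start a basis.  Repeating the argument modulo their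
    span saves a second generator, unless [N] is spanned by [v, B v].  In that case
    the other basis vectors are corrected by elements of [N]; either one of them
    generates [v], or [a ^ m] has, as [Gamma] is torsion-free, a coordinate prime to
    the order along one of them, which allows [v] to be added to this one. *)
From mathcomp Require Import all_boot all_order all_algebra all_fingroup all_field.
From mathcomp Require Import all_classical all_reals all_analysis.
From mathcomp Require Import ring lra zify.
Require Import Defs.

Set Implicit Arguments.
Unset Strict Implicit.
Unset Printing Implicit Defensive.

Import Order.TTheory GRing.Theory Num.Theory.
Import numFieldNormedType.Exports.
Local Open Scope classical_set_scope.
Local Open Scope ring_scope.

(** * Integral spans *)

Definition is_zsub (V : zmodType) (L : set V) : Prop :=
  [/\ L 0, forall x y, L x -> L y -> L (x + y) & forall x, L x -> L (- x)].

Section ZSpan.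
Variable V : zmodType.
Implicit Types (L : set V) (s : seq V) (x y z : V).

Lemma zsubB L x y : is_zsub L -> L x -> L y -> L (x - y).
Proof. by case=> _ LD LN Lx Ly; apply: LD => //; apply: LN. Qed.

Lemma zsubMn L x k : is_zsub L -> L x -> L (x *+ k).
Proof.
case=> L0 LD _ Lx; elim: k => [|k IHk]; first by rewrite mulr0n.
by rewrite mulrS; apply: LD.
Qed.

Lemma zsubMz L x (k : int) : is_zsub L -> L x -> L (x *~ k).
Proof.
move=> Lz Lx; have [_ _ LN] := Lz.
case: k => k; first by rewrite -pmulrn; apply: zsubMn.
by rewrite NegzE mulrNz; apply: LN; rewrite -pmulrn; apply: zsubMn.
Qed.

Fixpoint zspan s : set V :=
  if s is v :: s' then [set v *~ p.1 + p.2 | p in [set p : int * V | zspan s' p.2]]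
  else [set 0].

Lemma zspan_cons v s (k : int) x : zspan s x -> zspan (v :: s) (v *~ k + x).
Proof. by move=> sx; exists (k, x). Qed.

Lemma zspan_consP v s x :
  zspan (v :: s) x -> exists (k : int) y, zspan s y /\ x = v *~ k + y.
Proof. by case=> -[k y] /= sy <-; exists k, y. Qed.

Lemma zspan_zsub s : is_zsub (zspan s).
Proof.
elim: s => [|v s [s0 sD sN]].
  by split=> [|x y -> ->|x ->] //=; rewrite ?addr0 ?oppr0.
split=> [|x y|x].
- by rewrite -[0]addr0 -{1}(mulr0z v); apply: zspan_cons.
- move=> /zspan_consP[k [x' [sx ->]]] /zspan_consP[l [y' [sy ->]]].
  by rewrite addrACA -mulrzDr; apply: zspan_cons; apply: sD.
- move=> /zspan_consP[k [x' [sx ->]]].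
  by rewrite opprD -mulrNz; apply: zspan_cons; apply: sN.
Qed.

Lemma zspanW v s x : zspan s x -> zspan (v :: s) x.
Proof. by move=> sx; rewrite -[x]add0r -(mulr0z v); apply: zspan_cons. Qed.

Lemma zspan_mem s v : v \in s -> zspan s v.
Proof.
elim: s => // w s IHs; rewrite inE => /predU1P[->|/IHs]; last exact: zspanW.
have [s0 _ _] := zspan_zsub s.
by exists (1, 0) => //=; rewrite addr0.
Qed.

Lemma zspan_min L s : is_zsub L -> (forall v, v \in s -> L v) -> zspan s `<=` L.
Proof.
move=> Lz; elim: s => [|v s IHs] sL x; first by move=> ->; case: Lz.
move=> /zspan_consP[k [y [sy ->]]]; have [_ LD _] := Lz; apply: LD.
  by apply: zsubMz => //; apply: sL; rewrite mem_head.
by apply: IHs sy => w sw; apply: sL; rewrite inE sw orbT.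
Qed.

Lemma zspanS s1 s2 : {subset s1 <= s2} -> zspan s1 `<=` zspan s2.
Proof. by move=> s12; apply: zspan_min (zspan_zsub _) _ => v /s12/zspan_mem. Qed.

Lemma zspan_catP s1 s2 x :
  zspan (s1 ++ s2) x -> exists y z, [/\ zspan s1 y, zspan s2 z & x = y + z].
Proof.
elim: s1 x => [|v s1 IHs] x /=; first by exists 0, x; rewrite add0r.
move=> [[k y] /= /IHs[y1 [z [sy sz ->]]] <-]; exists (v *~ k + y1), z.
by split=> //; [apply: zspan_cons | rewrite addrA].
Qed.

Lemma zspan_cat s1 s2 x y : zspan s1 x -> zspan s2 y -> zspan (s1 ++ s2) (x + y).
Proof.
move=> sx sy; have [_ sD _] := zspan_zsub (s1 ++ s2); apply: sD.
  by apply: zspanS sx => v; rewrite mem_cat => ->.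
by apply: zspanS sy => v; rewrite mem_cat orbC => ->.
Qed.

(** Either [r] divides every coefficient and factors out, or the first coefficient that it does not
    divide is isolated. This singles out the generator that is modified in [merge_gens]. *)
Lemma zspan_dvdP (r : int) s x : zspan s x ->
  (exists2 y, zspan s y & x = y *~ r) \/
  (exists s1 v s2 k y, [/\ s = s1 ++ v :: s2, ~~ (r %| k)%Z,
     zspan (s1 ++ s2) y & x = v *~ k + y]).
Proof.
elim: s x => [|v s IHs] x.
  by move=> ->; left; exists 0 => //; rewrite mul0rz.
move=> /zspan_consP[k [y [sy ->]]].
have [/dvdzP[l ->]|rk] := boolP (r %| k)%Z; last first.
  by right; exists [::], v, s, k, y.
have [[z sz ->]|[s1 [w [s2 [k' [z [-> rk' sz ->]]]]]]] := IHs _ sy.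
  left; exists (v *~ l + z); first exact: zspan_cons.
  by rewrite mulrzDl mulrzA.
right; exists (v :: s1), w, s2, k', (v *~ (l * r) + z); split=> //.
  exact: zspan_cons.
by rewrite addrCA.
Qed.

End ZSpan.

(** * Rounding *)

Section Euclid.
Variables (R : realType) (n : nat).
Local Notation V := 'cV[R]_n.
Implicit Types (x y z u v w : V) (s : seq V) (P B : 'M[R]_n).

Definition dot x y : R := \sum_i x i 0 * y i 0.
Definition sqn x : R := dot x x.

Lemma dotC x y : dot x y = dot y x.
Proof. by apply: eq_bigr => i _; rewrite mulrC. Qed.

Lemma dotDl x y z : dot (x + y) z = dot x z + dot y z.
Proof. by rewrite -big_split; apply: eq_bigr => i _; rewrite mxE mulrDl. Qed.

Lemma dotZl a x y : dot (a *: x) y = a * dot x y.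
Proof. by rewrite mulr_sumr; apply: eq_bigr => i _; rewrite mxE mulrA. Qed.

Lemma dotDr x y z : dot z (x + y) = dot z x + dot z y.
Proof. by rewrite !(dotC z) dotDl. Qed.

Lemma dotZr a x y : dot y (a *: x) = a * dot y x.
Proof. by rewrite !(dotC y) dotZl. Qed.

Lemma dotNl x y : dot (- x) y = - dot x y.
Proof. by rewrite -scaleN1r dotZl mulN1r. Qed.

Lemma dotNr x y : dot x (- y) = - dot x y.
Proof. by rewrite dotC dotNl dotC. Qed.

Lemma dot0l x : dot 0 x = 0.
Proof. by rewrite -(scale0r 0) dotZl mul0r. Qed.

Lemma dot0r x : dot x 0 = 0.
Proof. by rewrite dotC dot0l. Qed.

Lemma sqn0 : sqn 0 = 0.
Proof. exact: dot0l. Qed.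

Lemma dot_mxE x y : dot x y = (x^T *m y) 0 0.
Proof. by rewrite mxE; apply: eq_bigr => i _; rewrite mxE. Qed.

Lemma dot_isom B x y : B^T *m B = 1%:M -> dot (B *m x) (B *m y) = dot x y.
Proof. by move=> BB; rewrite !dot_mxE trmx_mul mulmxA -(mulmxA x^T) BB mulmx1. Qed.

Lemma sqn_ge0 x : 0 <= sqn x.
Proof. by apply: sumr_ge0 => i _; rewrite -expr2 sqr_ge0. Qed.

Lemma sqn_eq0 x : (sqn x == 0) = (x == 0).
Proof.
apply/eqP/eqP => [x0|->]; last exact: dot0l.
apply/colP => i; rewrite mxE; apply/eqP; rewrite -sqrf_eq0 expr2; apply/eqP.
by move/psumr_eq0P: x0; apply=> // j _; rewrite -expr2 sqr_ge0.
Qed.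

Lemma sqn_gt0 x : (0 < sqn x) = (x != 0).
Proof. by rewrite lt_def sqn_eq0 sqn_ge0 andbT. Qed.

Lemma sqnN x : sqn (- x) = sqn x.
Proof. by rewrite /sqn dotNl dotNr opprK. Qed.

Lemma sqnDZ x v a : sqn (x + a *: v) = sqn x + 2 * a * dot x v + a ^+ 2 * sqn v.
Proof. by rewrite /sqn dotDl !dotDr !dotZl !dotZr (dotC v x); ring. Qed.

Lemma sqr_coord_le x i : x i 0 ^+ 2 <= sqn x.
Proof.
rewrite /sqn /dot (bigD1 i) //= expr2 lerDl.
by apply: sumr_ge0 => j _; rewrite -expr2 sqr_ge0.
Qed.

(* Rounding a up with probability theta := a - floor a and down otherwise has
   mean zero and variance theta (1 - theta), so one of the two outcomes is at
   least as good as the average. *)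
Lemma round1 P y v (a : R) : exists k : int,
  sqn (P *m (y + a *: v - v *~ k)) <=
  sqn (P *m y) + (a - (Num.floor a)%:~R) * (1 - (a - (Num.floor a)%:~R)) * sqn (P *m v).
Proof.
set f := Num.floor a; set th := a - f%:~R.
have th0 : 0 <= th by rewrite subr_ge0 Num.Theory.floor_le.
have th1 : th < 1.
  by rewrite ltrBlDr addrC -[X in _ < _ + X]/(1%:~R) -intrD Num.Theory.floorD1_gt.
have E (k : int) : sqn (P *m (y + a *: v - v *~ k)) =
    sqn (P *m y) + 2 * (a - k%:~R) * dot (P *m y) (P *m v) + (a - k%:~R) ^+ 2 * sqn (P *m v).
  by rewrite -sqnDZ -addrA -scaler_int -scalerBl mulmxDr scalemxAr.
set D := dot (P *m y) (P *m v) in E; set q := sqn (P *m v) in E *.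
have [D0|D0] := leP (2 * D + (2 * th - 1) * q) 0.
  exists f; rewrite E -/th; suff : th * (2 * D + (2 * th - 1) * q) <= 0 by lra.
  by apply: mulr_ge0_le0.
exists (f + 1); rewrite E intrD opprD addrA -/th.
suff : 0 <= (1 - th) * (2 * D + (2 * th - 1) * q) by lra.
by apply: mulr_ge0; lra.
Qed.

Lemma round1_le P y v (a : R) : exists k : int,
  sqn (P *m (y + a *: v - v *~ k)) <= sqn (P *m y) + sqn (P *m v) / 4.
Proof.
have [k ak] := round1 P y v a; exists k; apply: le_trans ak _; rewrite lerD2l.
set th := a - _; set q := sqn _; have q0 : 0 <= q by exact: sqn_ge0.
by have := mulr_ge0 (sqr_ge0 (th - 1 / 2)) q0; lra.
Qed.

Lemma zspan_span s x : zspan s x -> x \in << s >>%VS.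
Proof.
elim: s x => [|v s IHs] x; first by move=> ->; rewrite mem0v.
move=> /zspan_consP[k [y [/IHs sy ->]]]; rewrite -scaler_int span_cons.
by apply: memv_add => //; apply: memvZ; apply: memv_line.
Qed.

Lemma span_consP v s x : x \in << v :: s >>%VS ->
  exists a y, y \in << s >>%VS /\ x = a *: v + y.
Proof.
rewrite span_cons => /memv_addP[_ /vlineP[a ->] [y sy ->]].
by exists a, y.
Qed.

Lemma span_catP s1 s2 x : x \in << s1 ++ s2 >>%VS ->
  exists y z, [/\ y \in << s1 >>%VS, z \in << s2 >>%VS & x = y + z].
Proof. by rewrite span_cat => /memv_addP[y sy [z sz ->]]; exists y, z. Qed.

(** Coordinates are rounded one at a time. The offset [y] carries the errors already made, and each
    rounding costs at most a quarter of the squared length of the projected vector. *)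
Lemma zspan_round P s x y : x \in << s >>%VS ->
  exists2 z, zspan s z &
    sqn (P *m (y + x - z)) <= sqn (P *m y) + (\sum_(v <- s) sqn (P *m v)) / 4.
Proof.
elim: s x y => [|v s IHs] x y.
  rewrite span_nil memv0 => /eqP->; exists 0 => //.
  by rewrite big_nil mul0r !addr0 subr0.
move=> /span_consP[a [x' [sx' ->]]].
have [k yk] := round1_le P y v a.
have [z sz zk] := IHs x' (y + a *: v - v *~ k) sx'.
exists (v *~ k + z); first exact: zspan_cons.
have -> : y + (a *: v + x') - (v *~ k + z) = y + a *: v - v *~ k + x' - z.
  by rewrite opprD !addrA; congr (_ - _); rewrite -!addrA; congr (_ + (_ + _)); rewrite addrC.
by rewrite big_cons; lra.
Qed.

(* When both fractional parts are 1/2, the best of the two signs gains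
   |dot v w| / 2; otherwise a variance theta (1 - theta) is below 1/4. *)
Lemma zspan_round2 v w x : dot v w != 0 -> x \in << [:: v; w] >>%VS ->
  exists2 z, zspan [:: v; w] z & sqn (x - z) < (sqn v + sqn w) / 4.
Proof.
move=> vw0 /span_consP[a [_ [/span_consP[b [y [y0 ->]]] ->]]].
move: y0; rewrite span_nil memv0 => /eqP->.
have v0 : 0 < sqn v by rewrite sqn_gt0; apply: contraNneq vw0 => ->; rewrite dot0l.
have w0 : 0 < sqn w by rewrite sqn_gt0; apply: contraNneq vw0 => ->; rewrite dot0r.
have half (th : R) : th != 1 / 2 -> th * (1 - th) < 1 / 4.
  rewrite -subr_eq0 => thN; have := sqr_ge0 (th - 1 / 2).
  by rewrite le_eqVlt eq_sym sqrf_eq0 (negPf thN) /=; lra.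
have vw k l : zspan [:: v; w] (v *~ k + w *~ l).
  by apply: zspan_cons; rewrite -[w *~ l]addr0; apply: zspan_cons.
have [k] := round1 1%:M 0 v a; rewrite !mul1mx add0r sqn0.
have [l] := round1 1%:M (a *: v - v *~ k) w b; rewrite !mul1mx.
have -> : a *: v - v *~ k + b *: w - w *~ l = a *: v + (b *: w + 0) - (v *~ k + w *~ l).
  by rewrite addr0 opprD !addrA; congr (_ - _); rewrite addrAC.
set ta := a - _; set tb := b - _ => tbk tak.
have bound (th q : R) : 0 < q -> th * (1 - th) * q <= q / 4.
  by move=> q0; have := mulr_ge0 (sqr_ge0 (th - 1 / 2)) (ltW q0); lra.
have [ta2|/half] := eqVneq ta (1 / 2); last first.
  rewrite -(ltr_pM2r v0) => ta4; exists (v *~ k + w *~ l) => //.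
  by have := bound tb _ w0; lra.
have [tb2|/half] := eqVneq tb (1 / 2); last first.
  rewrite -(ltr_pM2r w0) => tb4; exists (v *~ k + w *~ l) => //.
  by have := bound ta _ v0; lra.
(* Both fractional parts are 1/2, so the error is half of [v + w] or of [v - w]; [c] picks the sign
   that makes the cross term negative. *)
pose c : int := if 0 < dot v w then 1 else 0.
exists (v *~ Num.floor a + w *~ (Num.floor b + c)) => //.
have -> : a *: v + (b *: w + 0) - (v *~ Num.floor a + w *~ (Num.floor b + c)) =
    ta *: v + (tb - c%:~R) *: w.
  have cE : tb - c%:~R = b - (Num.floor b + c)%:~R by rewrite intrD opprD addrA.
  rewrite cE /ta {cE} addr0 -(scaler_int (Num.floor a)) -(scaler_int (Num.floor b + c)).
  by rewrite opprD addrACA !scalerBl.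
rewrite sqnDZ -[ta *: v]add0r sqnDZ dot0l sqn0 add0r dotZl ta2 tb2.
rewrite {}/c; have [D0|] := ltP 0 (dot v w); first by rewrite mulr1z; lra.
by rewrite le_eqVlt (negPf vw0) /= mulr0z => D0; lra.
Qed.

(** Gram-Schmidt: [u] is the part of [w] orthogonal to the previous span; when it is nonzero, [P] is
    composed with the projector that kills [u]. *)
Lemma span_proj s : exists P : 'M[R]_n,
  (forall x, x - P *m x \in << s >>%VS) /\
  (forall x y, y \in << s >>%VS -> dot (P *m x) y = 0).
Proof.
elim: s => [|w s [P [Ps Po]]].
  exists 1%:M; split=> [x|x y]; rewrite mul1mx ?subrr ?mem0v //.
  by rewrite span_nil memv0 => /eqP->; rewrite dot0r.
set u := P *m w.
have wu : w - u \in << s >>%VS by exact: Ps.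
have swS y : y \in << s >>%VS -> y \in << w :: s >>%VS.
  by move=> sy; rewrite span_cons; apply: (subvP (addvSr _ _)).
have sw : w \in << w :: s >>%VS by apply: memv_span; rewrite mem_head.
have [u0|u0] := eqVneq u 0.
  exists P; split=> [x|x y]; first exact: swS.
  move=> /span_consP[a [z [sz ->]]].
  by rewrite dotDr dotZr !Po ?mulr0 ?addr0 //; rewrite u0 subr0 in wu.
have q0 : sqn u != 0 by rewrite sqn_eq0.
have su : u \in << w :: s >>%VS by rewrite -(subKr w u) memvB // swS.
exists (P - (sqn u)^-1 *: (u *m u^T *m P)).
have PE x : (P - (sqn u)^-1 *: (u *m u^T *m P)) *m x =
    P *m x - ((sqn u)^-1 * dot u (P *m x)) *: u.
  rewrite mulmxBl -scalemxAl -scalerA -!mulmxA; congr (_ - _ *: _).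
  rewrite [_^T *m _]mx11_scalar -dot_mxE.
  by rewrite mul_mx_scalar -scalemxAr.
split=> [x|x y sy]; rewrite PE.
  by rewrite opprB addrA addrAC; apply: memvD; [apply: swS | apply: memvZ].
have [a [z [sz ->]]] := span_consP sy.
have uz : dot u z = 0 by exact: Po.
have xw : dot (P *m x) w = dot (P *m x) u.
  by rewrite -[w in LHS](subrK u) dotDr Po // add0r.
have uw : dot u w = sqn u by rewrite -[w in LHS](subrK u) dotDr Po // add0r.
rewrite dotDl dotNl dotZl !dotDr !dotZr (Po x z sz) uz xw uw (dotC u) !addr0.
by field.
Qed.

End Euclid.

(** * Pure families in lattices *)

Section Lattices.
Variables (R : realType) (n : nat).
Local Notation V := 'cV[R]_n.
Implicit Types (x y z u v w : V) (s T : seq V) (P B : 'M[R]_n) (L N S : set V).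

(** Discreteness at the origin for the sup norm; for a subgroup it makes every bounded part
    finite. *)
Definition separated L : Prop :=
  exists2 e : R, 0 < e & forall x, L x -> x != 0 -> exists i, e <= `|x i 0|.

(** For a free family of vectors of [L], this is primitivity in the sense of lattices: the family
    extends to a basis. *)
Definition pure L s : Prop := forall x, L x -> x \in << s >>%VS -> zspan s x.

(** The two conditions characterize the orthogonal projection onto the orthogonal complement of the
    span, so [sqn (P *m x)] is the squared distance from [x] to the span. *)
Definition orthoproj P s : Prop :=
  (forall x, x - P *m x \in << s >>%VS) /\
  (forall x y, y \in << s >>%VS -> dot (P *m x) y = 0).

Lemma orthoproj_ker P s x : orthoproj P s -> x \in << s >>%VS -> P *m x = 0.
Proof.
case=> Ps Po sx; apply/eqP; rewrite -sqn_eq0 /sqn Po //.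
by rewrite -(subKr x (P *m x)) memvB.
Qed.

Lemma orthoproj_min P s x y : orthoproj P s -> y \in << s >>%VS ->
  sqn (P *m x) <= sqn (x - y).
Proof.
case=> Ps Po sy; have sz := memvB (Ps x) sy.
have -> : x - y = (x - P *m x - y) + 1 *: (P *m x).
  by rewrite scale1r addrAC subrK.
by rewrite sqnDZ dotC Po //; have := sqn_ge0 (x - P *m x - y); lra.
Qed.

(** Space is cut into cubes of side [e]. Two vectors of [L] in the same cube differ by less than [e]
    in each coordinate, so they coincide; a bounded [S] meets finitely many cubes, and [f] is
    minimized over these. *)
Lemma separated_min L S (f : V -> R) (M : R) :
  is_zsub L -> separated L -> S `<=` L -> (forall x, S x -> sqn x <= M) ->
  S !=set0 -> exists2 x, S x & forall y, S y -> f x <= f y.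
Proof.
move=> Lz [e e0 Le] SL SM [x0 Sx0].
(* From [sqn x <= M] follows [|x i 0| < M + 1], a bound without square roots; the cell indices then
   lie between [-K] and [K]. *)
pose K := Num.bound ((M + 1) / e).
pose cell (x : V) i : int := Num.floor (x i 0 / e).
pose code (x : V) : {ffun 'I_n -> 'I_(K + K).+1} :=
  [ffun i => inord (absz (cell x i + K%:Z))].
have cellP x i : S x -> - K%:Z <= cell x i <= K%:Z.
  move=> /SM xM; have := sqr_coord_le x i => xi.
  have M0 : 0 <= M := le_trans (sqn_ge0 x) xM.
  have /ltr_normlP[xl xr] : `|x i 0| < M + 1.
    rewrite -(ltr_pXn2r (n := 2)) // ?nnegrE //; last by lra.
    by rewrite real_normK ?num_real //; nra.
  have KM : (M + 1) / e < K%:R.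
    by apply: archi_boundP; apply: divr_ge0; lra.
  have xK : - K%:R <= x i 0 / e < K%:R.
    rewrite ler_pdivlMr // ltr_pdivrMr //.
    by move: KM; rewrite ltr_pdivrMr // mulNr; lra.
  case/andP: xK => Kx xK; rewrite floor_ge_int -ltzD1 floor_lt_int.
  by rewrite !rmorphN rmorphD /= -!pmulrn Kx; lra.
have codeI x y : S x -> S y -> code x = code y -> x = y.
  move=> Sx Sy xy; apply/eqP; rewrite -subr_eq0; apply: contraT => /Le.
  case=> [|i]; first by apply: zsubB => //; apply: SL.
  have /andP[xl xr] := cellP x i Sx; have /andP[yl yr] := cellP y i Sy.
  have : cell x i = cell y i.
    have := congr1 (fun c : {ffun _ -> _} => val (c i)) xy.
    by rewrite !ffunE /= !inordK; lia.
  rewrite /cell !mxE => cxy.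
  have /andP[xfl xfr] := floor_itv (x i 0 / e).
  have /andP[yfl yfr] := floor_itv (y i 0 / e).
  have : `|x i 0 / e - y i 0 / e| < 1.
    move: xfl xfr yfl yfr; rewrite {}cxy !rmorphD /= => *.
    by rewrite ltr_norml; apply/andP; split; lra.
  rewrite -mulrBl normrM normfV (gtr0_norm e0) ltr_pdivrMr // mul1r.
  by move=> lt /(lt_le_trans lt); rewrite ltxx.
pose P c := `[< exists2 x, S x & code x = c >].
pose rep c := xget 0 [set x | S x /\ code x = c].
have repP c : P c -> S (rep c) /\ code (rep c) = c.
  by move=> /asboolP[x Sx xc]; apply: (@xgetPex _ 0 [set x | S x /\ code x = c]); exists x.
have Px0 : P (code x0) by apply/asboolP; exists x0.
case: (Order.TotalTheory.arg_minP (fun c => f (rep c)) Px0) => c /repP[Sc _] cmin.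
exists (rep c) => // y Sy.
have Py : P (code y) by apply/asboolP; exists y.
have [Sy' /codeI yE] := repP _ Py.
by rewrite -(yE Sy' Sy); apply: cmin.
Qed.

End Lattices.

Section PureSublattices.
Variables (R : realType) (n : nat).
Local Notation V := 'cV[R]_n.
Implicit Types (x y z u v w : V) (s T : seq V) (P B : 'M[R]_n) (L N S : set V).

Lemma proj_zspan_round P s x : x \in << s >>%VS -> exists2 z, zspan s z &
  sqn (P *m (x - z)) <= (\sum_(v <- s) sqn (P *m v)) / 4.
Proof.
move=> sx; have [z sz] := zspan_round P 0 sx.
by rewrite add0r mulmx0 sqn0 add0r; exists z.
Qed.

(** Subtracting integral combinations of [s] does not change [P *m x] and, by rounding, brings the
    component along the span below [c]. The minimum may thus be sought among the bounded
    representatives in [S]. *)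
Lemma shortest_mod L N P s : is_zsub L -> separated L -> N `<=` L -> is_zsub N ->
  {in s, forall v, N v} -> orthoproj P s -> (exists2 x, N x & x \notin << s >>%VS) ->
  exists v, [/\ N v, v \notin << s >>%VS
    & forall x, N x -> x \notin << s >>%VS -> sqn (P *m v) <= sqn (P *m x)].
Proof.
move=> Lz Ls NL Nz sN Pp [x0 Nx0 sx0]; have [Ps Po] := Pp.
pose c := (\sum_(v <- s) sqn (1%:M *m v)) / 4.
pose M := 2 * (sqn (P *m x0) + c).
pose S := [set x | [/\ N x, x \notin << s >>%VS & sqn x <= M]].
have sNz : zspan s `<=` N by exact: zspan_min.
have reduce x : N x -> x \notin << s >>%VS -> sqn (P *m x) <= sqn (P *m x0) ->
    exists2 y, S y & sqn (P *m y) = sqn (P *m x).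
  move=> Nx sx xx0; have [z sz] := proj_zspan_round 1%:M (Ps x).
  rewrite mul1mx -/c => zc; have zs := zspan_span sz.
  have Pxz : P *m (x - z) = P *m x by rewrite mulmxBr (orthoproj_ker Pp zs) subr0.
  exists (x - z); last by rewrite Pxz.
  split; first by apply: zsubB => //; apply: sNz.
    by apply: contra sx => /memvD /(_ zs); rewrite subrK.
  have -> : x - z = x - P *m x - z + 1 *: (P *m x) by rewrite scale1r addrAC subrK.
  rewrite sqnDZ dotC Po; last by rewrite memvB.
  by have := sqn_ge0 (P *m x0); have := sqn_ge0 (x - P *m x - z); rewrite /M; lra.
have SL : S `<=` L by move=> x [/NL].
have [||v [Nv sv _] vmin] := @separated_min R n L S (fun x => sqn (P *m x)) M Lz Ls SL.
- by move=> x [].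
- by have [y Sy _] := reduce _ Nx0 sx0 (lexx _); exists y.
exists v; split=> // x Nx sx.
have [/(reduce _ Nx sx)[y /vmin + <-] //|/ltW x0x] := leP (sqn (P *m x)) (sqn (P *m x0)).
have [y /vmin vy yx0] := reduce _ Nx0 sx0 (lexx _).
by apply: le_trans vy _; rewrite yx0.
Qed.

(** After rounding, the error is a vector of [N] whose projection is shorter than the minimum [mu];
    it must lie in the span of [s], where purity is known. *)
Lemma pure_round N P s T (mu : R) : is_zsub N -> {in s ++ T, forall v, N v} ->
  orthoproj P s -> pure N s ->
  (forall x, N x -> x \notin << s >>%VS -> mu <= sqn (P *m x)) ->
  (forall t, t \in << T >>%VS -> exists2 z, zspan T z & sqn (P *m (t - z)) < mu) ->
  pure N (T ++ s).
Proof.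
move=> Nz sTN Pp Ns muP roundT x Nx /span_catP[t [y [Tt sy xty]]].
have [z Tz tz] := roundT t Tt.
have Nxz : N (x - z).
  apply: zsubB => //; apply: zspan_min Tz => // v vT; apply: sTN.
  by rewrite mem_cat vT orbT.
have sxz : x - z \in << s >>%VS.
  apply: contraT => /(muP _ Nxz).
  have -> : P *m (x - z) = P *m (t - z).
    by rewrite xty addrAC mulmxDr (orthoproj_ker Pp sy) addr0.
  by move=> /(lt_le_trans tz); rewrite ltxx.
by rewrite -(subrK z x) addrC; apply: zspan_cat => //; apply: Ns.
Qed.

Lemma pure_step N P s T (mu : R) : is_zsub N -> {in s ++ T, forall v, N v} ->
  orthoproj P s -> pure N s -> 0 < mu ->
  (forall x, N x -> x \notin << s >>%VS -> mu <= sqn (P *m x)) ->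
  {in T, forall v, sqn (P *m v) <= mu} -> (size T < 4)%N -> pure N (T ++ s).
Proof.
move=> Nz sTN Pp Ns mu0 muP Tmu T4; apply: (pure_round Nz sTN Pp Ns muP) => t Tt.
have [z Tz tz] := proj_zspan_round P Tt; exists z => //; apply: le_lt_trans tz _.
have : \sum_(v <- T) sqn (P *m v) <= mu *+ size T.
  have -> : mu *+ size T = \sum_(v <- T) mu.
    by rewrite big_const_seq count_predT iter_addr_0.
  by rewrite !big_seq; apply: ler_sum.
(* At most three vectors give a rounding error of at most [3 mu / 4], strictly below [mu]; four
   would only give [mu]. *)
move=> /le_trans/(_ (_ : _ <= mu *+ 3)); rewrite ler_pMn2l // => /(_ T4).
by rewrite -mulr_natr; lra.
Qed.

Lemma pure_nil N : pure N [::].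
Proof. by move=> x _; rewrite span_nil memv0 => /eqP->. Qed.

Lemma orthoproj_nil : orthoproj (1%:M : 'M[R]_n) [::].
Proof.
split=> [x|x y]; rewrite mul1mx ?subrr ?mem0v //.
by rewrite span_nil memv0 => /eqP->; rewrite dot0r.
Qed.

Lemma free_size s : free s -> (size s <= n)%N.
Proof. by move=> /eqP<-; rewrite (leq_trans (dimvS (subvf _))) // dimvf /dim /= muln1. Qed.

(** As long as [L] is not in the span of [s], a vector of [L] closest to this span among those
    outside it can be added, by [pure_step] with a single vector. *)
Lemma pure_complete L s : is_zsub L -> separated L -> {in s, forall v, L v} ->
  free s -> pure L s ->
  exists ws, [/\ (size ws + size s <= n)%N, {in ws, forall v, L v}
    & L `<=` zspan (ws ++ s)].
Proof.
move=> Lz Ls; have [k] := ubnP (n - size s); elim: k s => // k IHk s.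
move=> sk sL sfree spure.
have sn : (size s <= n)%N by exact: free_size.
have [Lsp|] := pselect (L `<=` [set x | x \in << s >>%VS]).
  by exists [::]; split=> // x Lx; apply: spure => //; apply: Lsp.
move=> /existsNP[x /not_implyP[Lx /negP sx]].
have [P Pp] := span_proj s.
have [|v [Lv sv vmin]] := shortest_mod Lz Ls (fun x => id) Lz sL Pp.
  by exists x.
have vsL : {in v :: s, forall w, L w}.
  by move=> w; rewrite inE => /predU1P[->|/sL].
have v0 : 0 < sqn (P *m v).
  rewrite sqn_gt0; apply: contraNneq sv => v0.
  by case: Pp => /(_ v); rewrite v0 subr0.
have [||||ws [wsn wsL Lws]] := IHk (v :: s).
- have : (size (v :: s) <= n)%N.
    by apply: free_size; rewrite free_cons sv.
  by move: sk => /=; lia.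
- by [].
- by rewrite free_cons sv.
- apply: (@pure_step L P s [:: v] _ Lz _ Pp spure v0 vmin) => //.
  by move=> w; rewrite mem_cat mem_seq1 orbC => ?; apply: vsL; rewrite inE.
  by move=> w; rewrite inE => /eqP->.
exists (rcons ws v); split; last by move=> y /Lws; rewrite cat_rcons.
  by move: wsn; rewrite size_rcons /= addnS.
by move=> w; rewrite mem_rcons inE => /predU1P[->|/wsL].
Qed.

End PureSublattices.

(** * Automorphisms of prime order at least 5 *)

(** The second polynomial is the [p]-th cyclotomic one. A root of a nonconstant common divisor would
    be a primitive [p]-th root of unity, whose minimal polynomial has size [p] and would divide
    [f]. *)
Lemma coprimep_poly1 p (f : {poly rat}) : prime p -> f != 0 -> (size f < p)%N ->
  coprimep f (\poly_(i < p) 1).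
Proof.
move=> pp f0 fp; apply/coprimepP => d df dp.
have d0 : d != 0 by apply: contraNneq f0 => d0; move: df; rewrite d0 dvd0p.
rewrite -size_poly_eq1; apply: contraT => d1.
pose toC : {poly rat} -> {poly algC} := map_poly ratr.
have [z dz] : exists z, root (toC d) z.
  by apply/closed_rootP; rewrite size_map_poly.
have z_root g : d %| g -> root (toC g) z.
  by case/dvdpP => h ->; rewrite /toC rmorphM rootM dz orbT.
have p1E : toC (\poly_(i < p) 1) = \sum_(i < p) 'X^i.
  apply/polyP => i; rewrite coef_map coef_poly coef_sum.
  under eq_bigr => k _ do rewrite coefXn.
  have [ip|ip] := ltnP i p; last first.
    rewrite /= rmorph0 big1 // => k _; case: eqP => // ik.
    by move: (ltn_ord k) ip; rewrite -ik; lia.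
  rewrite /= rmorph1 (bigD1 (Ordinal ip)) //= eqxx big1 ?addr0 // => k.
  by rewrite -val_eqE /= eq_sym => /negPf->.
have zsum : \sum_(i < p) z ^+ i = 0.
  have /rootP := z_root _ dp; rewrite p1E horner_sum => z0; rewrite -[RHS]z0.
  by apply: eq_bigr => i _; rewrite hornerXn.
have zp : z ^+ p = 1 by apply/eqP; rewrite -subr_eq0 subrX1 zsum mulr0.
have [k zk kp] := prim_order_exists (prime_gt0 pp) zp.
have prim : p.-primitive_root z.
  (* The order of [z] is 1 or [p]; if it were 1, the vanishing sum of powers would equal [p]. *)
  have /primeP[_ /(_ _ kp)/predU1P[k1|/eqP<- //]] := pp.
  move: zk; rewrite k1 => /prim_expr_order; rewrite expr1 => z1.
  move: zsum; rewrite z1; under eq_bigr => i _ do rewrite expr1n.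
  by rewrite sumr_const card_ord => /eqP; rewrite pnatr_eq0 (gtn_eqF (prime_gt0 pp)).
have [q [mq _] qP] := minCpolyP z.
have := qP f; rewrite z_root // => /esym /(dvdp_leq f0).
have <- : size (minCpoly z) = size q by rewrite mq size_map_poly.
rewrite (minCpoly_cyclotomic prim) size_cyclotomic totient_prime //.
by rewrite prednK ?prime_gt0 // leqNgt fp.
Qed.

(** * Orbits of a vector under the powers of a matrix *)

Section MatrixPowers.
Variables (R : realType) (n : nat).
Local Notation V := 'cV[R]_n.
Implicit Types (x y z u v w : V) (s T : seq V) (B M : 'M[R]_n) (L N : set V).

Lemma span_mulmx_sub B s s' x : {in s, forall v, B *m v \in << s' >>%VS} ->
  x \in << s >>%VS -> B *m x \in << s' >>%VS.
Proof.
elim: s x => [|v s IHs] x sB; first by rewrite span_nil memv0 => /eqP->; rewrite mulmx0 mem0v.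
move=> /span_consP[a [y [sy ->]]]; rewrite mulmxDr -scalemxAr.
apply: memvD; first by apply: memvZ; apply: sB; rewrite mem_head.
by apply: IHs sy => w sw; apply: sB; rewrite inE sw orbT.
Qed.

Lemma span_mulmx0 M s x : {in s, forall v, M *m v = 0} -> x \in << s >>%VS -> M *m x = 0.
Proof.
move=> sM /(@span_mulmx_sub M s [::]); rewrite span_nil memv0 => H; apply/eqP/H.
by move=> v /sM->; rewrite mem0v.
Qed.

Lemma exprS_mulmx B k v : B ^+ k.+1 *m v = B *m (B ^+ k *m v).
Proof. by rewrite mulmxA exprS. Qed.

Lemma exprD_mulmx B k l v : B ^+ (k + l) *m v = B ^+ k *m (B ^+ l *m v).
Proof. by rewrite mulmxA exprD. Qed.

Lemma orth_exp B k : B^T *m B = 1%:M -> (B ^+ k)^T *m B ^+ k = 1%:M.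
Proof.
move=> BB; elim: k => [|k IHk]; first by rewrite expr0 trmx1 mulmx1.
by rewrite exprS trmx_mul mulmxA -(mulmxA _ _ B) BB mulmx1.
Qed.

Lemma stable_exp (J : set V) B k x : (forall x, J x -> J (B *m x)) -> J x -> J (B ^+ k *m x).
Proof.
move=> JB Jx; elim: k => [|k IHk]; first by rewrite expr0 mul1mx.
by rewrite exprS_mulmx; apply: JB.
Qed.

(** The highest power comes first, so that an induction on [j] adds a vector at the head, as in
    [free_cons]. *)
Fixpoint orb B v j : seq V := if j is i.+1 then B ^+ i *m v :: orb B v i else [::].

Lemma size_orb B v j : size (orb B v j) = j.
Proof. by elim: j => //= j ->. Qed.

Lemma orbP B v j w : w \in orb B v j -> exists i, w = B ^+ i *m v.
Proof. by elim: j => //= j IHj; rewrite inE => /predU1P[->|/IHj //]; exists j. Qed.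

End MatrixPowers.

Section OrbitIndependence.
Variables (R : realType) (n' : nat).
Local Notation n := n'.+1.
Local Notation V := 'cV[R]_n.
Implicit Types (x y z u v w : V) (s T : seq V) (B M : 'M[R]_n) (L N : set V).
Local Notation phi B f := (horner_mx B (map_poly ratr f)).

Lemma zspan_orb B v j x : zspan (orb B v j) x ->
  exists2 g : {poly rat}, (size g <= j)%N & x = phi B g *m v.
Proof.
elim: j x => [|j IHj] x /=.
  by move=> ->; exists 0; rewrite ?size_poly0 // rmorph0 rmorph0 mul0mx.
move=> /zspan_consP[k [y [/IHj[g gj ->] ->]]].
exists (k%:~R *: 'X^j + g).
  rewrite (leq_trans (size_polyD _ _)) // geq_max (leq_trans gj) // andbT.
  by rewrite (leq_trans (size_scale_leq _ _)) // size_polyXn.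
rewrite !rmorphD /= map_polyZ map_polyXn /= rmorph_int.
by rewrite linearZ /= rmorphXn /= horner_mx_X mulmxDl -scalemxAl -scaler_int.
Qed.

(** An integral relation would give a rational polynomial [f] of degree [j] with [f(B) v = 0]. The
    cyclotomic polynomial also kills [v] and is coprime to [f], so a Bezout identity gives
    [v = 0]. *)
Lemma orb_notin B v p j : prime p -> (j.+1 < p)%N -> v != 0 ->
  (\sum_(k < p) B ^+ k) *m v = 0 -> ~ zspan (orb B v j) (B ^+ j *m v).
Proof.
move=> pp jp v0 Sv /zspan_orb[g gj gv].
pose f : {poly rat} := 'X^j - g.
have fsize : size f = j.+1 by rewrite /f size_polyDl ?size_polyXn // size_polyN.
have f0 : f != 0 by rewrite -size_poly_gt0 fsize.
have := coprimep_poly1 pp f0; rewrite fsize => /(_ jp) /Bezout_eq1_coprimepP[[a b] /=].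
move=> /(congr1 (fun h => phi B h *m v)).
have -> : phi B (1 : {poly rat}) *m v = v by rewrite !rmorph1 mul1mx.
have fv : phi B f *m v = 0.
  by rewrite /f !rmorphB /= map_polyXn rmorphXn /= horner_mx_X mulmxBl gv subrr.
have pv : phi B (\poly_(i < p) 1) *m v = 0.
  rewrite -[RHS]Sv; congr (_ *m v); rewrite poly_def !rmorph_sum /=.
  by apply: eq_bigr => i _; rewrite scale1r map_polyXn rmorphXn /= horner_mx_X.
rewrite !rmorphD !rmorphM /= mulmxDl -!mulmxA fv pv !mulmx0 addr0 => /esym/eqP.
by rewrite (negPf v0).
Qed.

End OrbitIndependence.

Section PrimeGens.
Variables (R : realType) (n' : nat).
Local Notation n := n'.+1.
Local Notation V := 'cV[R]_n.
Implicit Types (x y z u v w : V) (s T : seq V) (B M : 'M[R]_n) (L N J : set V).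

Lemma zsub_ker M L : is_zsub L -> is_zsub [set x | L x /\ M *m x = 0].
Proof.
move=> [L0 LD LN]; split=> [|x y [Lx Mx] [Ly My]|x [Lx Mx]]; split=> //.
- by rewrite mulmx0.
- exact: LD.
- by rewrite mulmxDr Mx My addr0.
- exact: LN.
- by rewrite mulmxN Mx oppr0.
Qed.

(** A kernel is a linear condition: a vector of [L] in the real span of [s] is killed by [M] too. *)
Lemma pure_ker L N M s : (forall x, L x -> M *m x = 0 -> N x) ->
  {in s, forall v, M *m v = 0} -> pure N s -> pure L s.
Proof. by move=> MN sM Ns x Lx sx; apply: Ns => //; apply: MN => //; apply: span_mulmx0 sx. Qed.

(** As [i] is invertible modulo [p], [B] is itself a power of [B ^+ i]. *)
Lemma expX1_eq1 B p i v : prime p -> (0 < i < p)%N -> B ^+ p = 1 ->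
  B ^+ i *m v = v -> B *m v = v.
Proof.
move=> pp /andP[i0 ip] Bp Bi.
have : coprime i p by rewrite coprime_sym prime_coprime // gtnNdvd.
case/(coprimeP _ i0) => -[a b] /= ab.
have Bk k : B ^+ (i * k) *m v = v.
  by elim: k => [|k IHk]; rewrite ?muln0 ?expr0 ?mul1mx // mulnS exprD_mulmx IHk.
have Bpk k : B ^+ (p * k) *m v = v by rewrite exprM Bp expr1n mul1mx.
have E : (i * a = p * b + 1)%N by rewrite mulnC (mulnC p); lia.
by rewrite -{2}(Bk a) E addnC exprD_mulmx Bpk expr1.
Qed.

(** The cyclotomic polynomial may factor over the reals, so irreducibility excludes rational
    relations only; purity turns a real relation into an integral one. *)
Lemma orb_free B v p : prime p -> (3 < p)%N -> v != 0 -> (\sum_(k < p) B ^+ k) *m v = 0 ->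
  (forall j, (j < 4)%N -> pure [set x | exists i, x = B ^+ i *m v] (orb B v j)) ->
  free (orb B v 4).
Proof.
move=> pp p3 v0 Sv orbp.
have p4 : (4 < p)%N by move: p3 pp; rewrite leq_eqVlt => /predU1P[<-|].
suff orbf j : (j <= 4)%N -> free (orb B v j) by exact: orbf.
elim: j => [|j IHj] j4; first exact: nil_free.
rewrite /= free_cons IHj 1?ltnW // andbT; apply/negP => jv.
apply: (orb_notin pp _ v0 Sv (j := j)); first by apply: leq_trans p4.
by apply: orbp => //; exists j.
Qed.

(** Generation as a module is expressed through all stable subgroups [J]. Four basis vectors
    [C ^+ k *m v] are replaced by the single generator [v], which saves three. *)
Lemma prime_gens L B p : is_zsub L -> separated L -> B^T *m B = 1%:M ->
  (forall x, L x -> L (B *m x)) -> prime p -> (3 < p)%N -> B ^+ p = 1 ->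
  (exists2 x, L x & B *m x != x) ->
  exists ws, [/\ (size ws + 3 <= n)%N, {in ws, forall v, L v}
    & forall J, is_zsub J -> (forall x, J x -> J (B *m x)) ->
        {in ws, forall v, J v} -> L `<=` J].
Proof.
move=> Lz Ls BB LB pp p3 Bp [x0 Lx0 x0B].
pose S := \sum_(k < p) B ^+ k.
have SB : S * (B - 1) = 0.
  have <- : B ^+ p - 1 = 0 by rewrite Bp subrr.
  rewrite subrX1; apply: commr_sym; apply: commr_sum => k _.
  by apply/commr_sym/commrB; [apply/commr_sym/commrX | apply: commr1].
pose N := [set x | L x /\ S *m x = 0].
have NL : N `<=` L by move=> x [].
have Nz : is_zsub N by exact: zsub_ker.
have SBc : S * B = B * S.
  by rewrite mulr_sumr mulr_suml; apply: eq_bigr => k _; rewrite -exprSr exprS.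
have NB x : N x -> N (B *m x).
  move=> [Lx Sx]; split; first exact: LB.
  by rewrite mulmxA -[S *m B]/(S * B) SBc -mulmxA Sx mulmx0.
(* [S * (B - 1) = B ^+ p - 1 = 0], so the image of [B - 1] lies in the kernel of [S]. *)
have exN : exists2 x, N x & x \notin << [::] >>%VS.
  exists ((B - 1) *m x0).
    split; last by rewrite mulmxA -[S *m _]/(S * (B - 1)) SB mul0mx.
    by rewrite mulmxBl mul1mx; apply: zsubB => //; apply: LB.
  by rewrite span_nil memv0 mulmxBl mul1mx subr_eq0.
have [|v [Nv]] := shortest_mod Lz Ls NL Nz _ (orthoproj_nil R n) exN; first by [].
rewrite span_nil memv0 mul1mx => v0 vmin.
have vmin' x : N x -> x != 0 -> sqn v <= sqn x.
  by move=> Nx x0'; have := vmin x Nx; rewrite memv0 mul1mx; apply.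
have q0 : 0 < sqn v by rewrite sqn_gt0.
have [Lv Sv] := Nv.
(* Otherwise only the term [k = 0] would contribute to [dot (S *m v) v], which would be [sqn v]
   instead of 0. *)
have [i /andP[i0 ip] iv] : exists2 i : nat, (0 < i < p)%N & dot (B ^+ i *m v) v != 0.
  apply: contrapT => none.
  have : dot (S *m v) v = sqn v.
    rewrite /S -(prednK (prime_gt0 pp)) big_ord_recl expr0 mulmxDl mul1mx dotDl mulmx_suml.
    suff -> : dot (\sum_(k < p.-1) B ^+ lift ord0 k *m v) v = 0 by rewrite addr0.
    elim/big_ind: _ => [|x y x0' y0|k _]; first exact: dot0l.
      by rewrite dotDl x0' y0 addr0.
    apply/eqP; apply: contrapT => /negP kv; apply: none; exists (lift ord0 k) => //.
    by have := ltn_ord k; rewrite lift0 /=; lia.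
  by rewrite Sv dot0l => q; rewrite -q ltxx in q0.
pose C := B ^+ i.
have CC : C^T *m C = 1%:M by exact: orth_exp.
have NC k x : N x -> N (C ^+ k *m x) by move=> Nx; rewrite -exprM; apply: stable_exp.
have Cp : C ^+ p = 1 by rewrite -exprM mulnC exprM Bp expr1n.
(* This sum [y] is fixed by [C], hence by [B]; as [y] lies in [N], [0 = S *m y = p y]. *)
have SCv : (\sum_(k < p) C ^+ k) *m v = 0.
  set y := _ *m v.
  have Ny : N y.
    rewrite /y mulmx_suml; have [N0 ND _] := Nz; elim/big_ind: _ => // k _; exact: NC.
  have By : B *m y = y.
    apply: (@expX1_eq1 _ p i); rewrite ?i0 ?ip //.
    apply/eqP; rewrite -subr_eq0 -[X in _ - X]mul1mx -mulmxBl /y mulmxA.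
    have -> : (B ^+ i - 1%:M) *m (\sum_(k < p) C ^+ k) = 0.
      by rewrite -[LHS]/((C - 1) * _) -subrX1 Cp subrr.
    by rewrite mul0mx.
  have [_] := Ny; have -> : S *m y = y *+ p.
    rewrite /S mulmx_suml -[p in RHS]card_ord -sumr_const; apply: eq_bigr => k _.
    by elim: (k : nat) => [|l IHl]; rewrite ?expr0 ?mul1mx // exprS_mulmx IHl.
  rewrite -scaler_nat => /eqP; rewrite scaler_eq0 pnatr_eq0 (gtn_eqF (prime_gt0 pp)) /=.
  by move/eqP.
have sqC k : sqn (C ^+ k *m v) = sqn v by apply: dot_isom; apply: orth_exp.
have orbN j : {in orb C v j, forall w, N w} by move=> w /orbP[k ->]; apply: NC.
have muN x : N x -> x \notin << [::] : seq V >>%VS -> sqn v <= sqn (1%:M *m x).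
  by rewrite span_nil memv0 mul1mx; apply: vmin'.
have orbp j : (j < 4)%N -> pure N (orb C v j).
  move=> j4; rewrite -[orb C v j]cats0.
  apply: (@pure_step R n N 1%:M [::] (orb C v j) (sqn v) Nz _
    (orthoproj_nil R n) (@pure_nil R n N) q0 muN) => //.
  - exact: orbN.
  - by move=> w /orbP[k ->]; rewrite mul1mx sqC.
  - by rewrite size_orb.
have fr : free (orb C v 4).
  apply: (orb_free pp p3 v0 SCv) => j j4 x [k ->]; apply: orbp => //; exact: NC.
have orbp4 : pure N (orb C v 4).
  rewrite -[orb C v 4]cats0.
  apply: (@pure_round R n N 1%:M [::] (orb C v 4) (sqn v) Nz _
    (orthoproj_nil R n) (@pure_nil R n N) muN) => //; first exact: orbN.
  move=> t.
  (* The pair [C *m v], [v] is not orthogonal, so it rounds with error strictly below [sqn v / 2];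
     the other pair adds at most [sqn v / 2]. *)
  rewrite -[orb C v 4]/([:: C ^+ 3 *m v; C ^+ 2 *m v] ++ [:: C ^+ 1 *m v; C ^+ 0 *m v]).
  move=> /span_catP[t1 [t2 [st1 st2 ->]]].
  have [|z2 sz2] := zspan_round2 _ st2; first by rewrite expr0 expr1 mul1mx.
  rewrite !sqC => z2q.
  have [z1 sz1] := zspan_round 1%:M (t2 - z2) st1.
  rewrite !big_cons big_nil !mul1mx !sqC => z1q.
  exists (z1 + z2); first by have := zspan_cat sz1 sz2; rewrite expr0 mul1mx.
  rewrite mul1mx (_ : _ - _ = t2 - z2 + t1 - z1); first by lra.
  by rewrite opprD addrACA addrC addrA.
have orbL : pure L (orb C v 4).
  by apply: (pure_ker (M := S)) orbp4 => [x Lx Sx|w /orbN[]].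
have [|ws [wsn wsL Lws]] := pure_complete Lz Ls _ fr orbL.
  by move=> w /orbN/NL.
exists (v :: ws); split.
- by move: wsn; rewrite size_orb /=; lia.
- by move=> w; rewrite inE => /predU1P[->|/wsL].
move=> J Jz JB wsJ x /Lws; apply: zspan_min => // w; rewrite mem_cat => /orP[ww|/orbP[k ->]].
  by apply: wsJ; rewrite inE ww orbT.
by rewrite -exprM; apply: stable_exp => //; apply: wsJ; rewrite mem_head.
Qed.

End PrimeGens.

(** * Automorphisms of order 3 and 4 *)

Section QuadraticGens.
Variables (R : realType) (n' : nat).
Local Notation n := n'.+1.
Local Notation V := 'cV[R]_n.
Implicit Types (x y z u v w : V) (s T : seq V) (B M : 'M[R]_n) (L N J : set V).

Lemma mulmx_mulrz B x (k : int) : B *m (x *~ k) = (B *m x) *~ k.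
Proof. by rewrite -scaler_int -scalemxAr scaler_int. Qed.

Lemma zsub_fixed B L : is_zsub L -> is_zsub [set x | L x /\ B *m x = x].
Proof.
move=> [L0 LD LN]; split=> [|x y [Lx Bx] [Ly By]|x [Lx Bx]]; split=> //.
- by rewrite mulmx0.
- exact: LD.
- by rewrite mulmxDr Bx By.
- exact: LN.
- by rewrite mulmxN Bx.
Qed.

(** Modulo the stable span of [s], [v] would be an eigenvector of [B] for a real root of
    [X^2 + e X + 1], whose discriminant is negative. *)
Lemma quad_notin B (e : R) s v : e ^+ 2 < 4 -> {in s, forall w, B *m w \in << s >>%VS} ->
  v \notin << s >>%VS -> B *m (B *m v) = - (e *: (B *m v)) - v ->
  B *m v \notin << v :: s >>%VS.
Proof.
move=> e4 sB sv BBv; apply: contra sv => /span_consP[a [y [sy Bv]]].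
move: BBv; rewrite {1}Bv mulmxDr -scalemxAr Bv => BBv.
have : (a ^+ 2 + e * a + 1) *: v = - (B *m y + (a + e) *: y).
  have -> : B *m y = - (e *: (a *: v + y)) - v - a *: (a *: v + y).
    by rewrite -BBv addrAC subrr add0r.
  by apply/colP => i; rewrite !mxE; ring.
have c0 : a ^+ 2 + e * a + 1 != 0.
  by apply: lt0r_neq0; have := sqr_ge0 (a + e / 2); nra.
move=> /(congr1 ( *:%R (a ^+ 2 + e * a + 1)^-1)); rewrite scalerA mulVf // scale1r => ->.
by rewrite memvZ // memvN memvD ?memvZ //; apply: span_mulmx_sub sy.
Qed.

Lemma quad_step L N B (e : R) s : e ^+ 2 < 4 -> is_zsub L -> separated L ->
  B^T *m B = 1%:M -> N `<=` L -> is_zsub N -> (forall x, N x -> N (B *m x)) ->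
  (forall x, N x -> B *m (B *m x) = - (e *: (B *m x)) - x) ->
  {in s, forall w, N w} -> {in s, forall w, B *m w \in << s >>%VS} ->
  free s -> pure N s -> (exists2 x, N x & x \notin << s >>%VS) ->
  exists v, [/\ N v, free [:: B *m v, v & s] & pure N [:: B *m v, v & s]].
Proof.
move=> e4 Lz Ls BB NL Nz NB Nq sN sB sf sp ex.
have [P Pp] := span_proj s; have [Ps Po] := Pp.
have [v [Nv sv vmin]] := shortest_mod Lz Ls NL Nz sN Pp ex.
exists v; split=> //.
  by rewrite !free_cons sv sf (quad_notin e4) //; apply: Nq.
have v0 : 0 < sqn (P *m v).
  rewrite sqn_gt0; apply: contraNneq sv => v0.
  by case: Pp => /(_ v); rewrite v0 subr0.
apply: (@pure_step R n N P s [:: B *m v; v] _ Nz _ Pp sp v0 vmin) => //.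
  move=> w; rewrite mem_cat !inE => /orP[/sN //|/orP[]/eqP-> //]; exact: NB.
move=> w; rewrite !inE => /orP[]/eqP-> //.
(* The span of [s] is stable under the isometry [B], so [B *m v] is no farther from it than [v], and
   [pure_step] applies to the two vectors. *)
apply: le_trans (orthoproj_min (y := B *m (v - P *m v)) _ Pp _) _.
  by apply: span_mulmx_sub (Ps v).
by rewrite -mulmxBr subKr [sqn _]dot_isom.
Qed.

(** For [e = 1] and [e = 0], [X^2 + e X + 1] is the cyclotomic polynomial of order 3 and 4. If its
    kernel holds a second pair [u], [B *m u], two generators are saved. Otherwise [v] and [B *m v]
    span the kernel, and [ws] with [v] is still one generator too many. *)
Lemma quad_split L B (e : R) : e ^+ 2 < 4 -> is_zsub L -> separated L ->
  B^T *m B = 1%:M -> (forall x, L x -> L (B *m x)) ->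
  (exists x, [/\ L x, x != 0 & B *m (B *m x) = - (e *: (B *m x)) - x]) ->
  (exists ws, [/\ (size ws + 2 <= n)%N, {in ws, forall w, L w} &
     forall J, is_zsub J -> (forall x, J x -> J (B *m x)) ->
       {in ws, forall w, J w} -> L `<=` J]) \/
  (exists v ws, [/\ L v, B *m (B *m v) = - (e *: (B *m v)) - v, v != 0,
     (size ws + 2 <= n)%N & {in ws, forall w, L w}] /\
     [/\ L `<=` zspan (ws ++ [:: B *m v; v]) &
     forall x, L x -> B *m (B *m x) = - (e *: (B *m x)) - x -> zspan [:: B *m v; v] x]).
Proof.
move=> e4 Lz Ls BB LB [x0 [Lx0 x00 x0q]].
pose M := B *m B + e *: B + 1%:M.
have ME x : M *m x = B *m (B *m x) + e *: (B *m x) + x.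
  by rewrite !mulmxDl mul1mx -scalemxAl mulmxA.
pose N := [set x | L x /\ M *m x = 0].
have Nq x : N x -> B *m (B *m x) = - (e *: (B *m x)) - x.
  by move=> [_]; rewrite ME => /eqP; rewrite -addrA addr_eq0 opprD => /eqP.
have qN x : L x -> B *m (B *m x) = - (e *: (B *m x)) - x -> N x.
  by move=> Lx xq; split; rewrite // ME xq -addrA -opprD addNr.
have NL : N `<=` L by move=> x [].
have Nz : is_zsub N by exact: zsub_ker.
have NB x : N x -> N (B *m x).
  move=> Nx; apply: qN; first by apply/LB/NL.
  by have := congr1 (mulmx B) (Nq x Nx); rewrite mulmxBr mulmxN -scalemxAr.
have [|||||v [Nv vf vp]] := @quad_step L N B e [::] e4 Lz Ls BB NL Nz NB Nq.
- by [].
- by [].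
- exact: nil_free.
- exact: pure_nil.
- by exists x0; [apply: qN | rewrite span_nil memv0].
have vN : {in [:: B *m v; v], forall w, N w}.
  by move=> w; rewrite !inE => /orP[]/eqP-> //; apply: NB.
have vB : {in [:: B *m v; v], forall w, B *m w \in << [:: B *m v; v] >>%VS}.
  have mBv : B *m v \in << [:: B *m v; v] >>%VS by apply: memv_span; rewrite mem_head.
  have mv : v \in << [:: B *m v; v] >>%VS by apply: memv_span; rewrite !inE eqxx orbT.
  move=> w; rewrite !inE => /orP[]/eqP-> //.
  by rewrite Nq // memvB // memvN memvZ.
have M0 T : {in T, forall w, N w} -> {in T, forall w, M *m w = 0} by move=> TN w /TN[].
have NM x : L x -> M *m x = 0 -> N x by [].
have [ex|noex] := pselect (exists2 x, N x & x \notin << [:: B *m v; v] >>%VS).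
  left.
  have [u [Nu uf up]] := quad_step e4 Lz Ls BB NL Nz NB Nq vN vB vf vp ex.
  have uN : {in [:: B *m u, u, B *m v & [:: v]], forall w, N w}.
    move=> w; rewrite !inE => /or4P[]/eqP-> //; exact: NB.
  have [|ws [wsn wsL Lws]] := pure_complete Lz Ls _ uf (pure_ker NM (M0 _ uN) up).
    by move=> w /uN/NL.
  exists [:: u, v & ws]; split.
  - by move: wsn => /=; lia.
  - by move=> w; rewrite !inE => /or3P[/eqP->|/eqP->|/wsL //]; apply: NL.
  move=> J Jz JB Jws x /Lws; apply: zspan_min => // w.
  have Ju : J u by apply: Jws; rewrite !inE eqxx.
  have Jv : J v by apply: Jws; rewrite !inE eqxx orbT.
  rewrite mem_cat => /orP[ww|]; first by apply: Jws; rewrite !inE ww !orbT.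
  by rewrite !inE => /or4P[]/eqP-> //; apply: JB.
right.
have [|ws [wsn wsL Lws]] := pure_complete Lz Ls _ vf (pure_ker NM (M0 _ vN) vp).
  by move=> w /vN/NL.
exists v, ws; split; split=> //.
- exact: NL.
- exact: Nq.
- by move: vf; rewrite !free_cons span_nil memv0 => /and3P[].
move=> x Lx xq; apply: vp; first exact: qN.
by apply: contrapT => /negP sx; apply: noex; exists x => //; apply: qN.
Qed.

Lemma zsub_coprime J x (k r : int) : is_zsub J -> coprimez k r ->
  J (x *~ k) -> J (x *~ r) -> J x.
Proof.
move=> Jz /coprimezP[[a b] /= ab] Jk Jr; have [_ JD _] := Jz.
rewrite -[x]mulr1z -ab mulrzDr; apply: JD; rewrite mulrC mulrzA; exact: zsubMz.
Qed.

(** [p f = p (f + v) - p v] lies in [J], and so does [k f] with [k] prime to [p]. *)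
Lemma zsub_merge J f v (p : nat) (k : int) : is_zsub J -> prime p -> ~~ (p %| k)%Z ->
  J (f *~ k) -> J (v *~ p) -> J (f + v) -> J f /\ J v.
Proof.
move=> Jz pp pk Jf Jv Jfv.
have Jfp : J (f *~ p).
  rewrite -[f](addrK v) mulrzBl; apply: zsubB => //; exact: zsubMz.
have f_J : J f.
  apply: zsub_coprime Jf Jfp => //.
  by rewrite coprimezE coprime_sym prime_coprime.
by split=> //; have := zsubB Jz Jfv f_J; rewrite addrAC subrr add0r.
Qed.

(** A unitriangular change of generators modulo the span of [T]. *)
Lemma adjust_list (Q : set V) ws T (L : set V) :
  {in ws, forall w, exists f, [/\ Q f, L f & zspan T (w - f)]} ->
  exists fs, [/\ size fs = size ws, {in fs, forall f, Q f /\ L f} &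
    zspan (ws ++ T) `<=` zspan (fs ++ T)].
Proof.
elim: ws => [|w ws IHws] wsQ; first by exists [::]; split=> //.
have [|fs [fsn fsQ fsT]] := IHws; first by move=> x xw; apply: wsQ; rewrite inE xw orbT.
have [f [Qf Lf Twf]] := wsQ w (mem_head _ _).
exists (f :: fs); split=> /=; first by rewrite fsn.
  by move=> x; rewrite inE => /predU1P[->|/fsQ].
move=> _ [[k y] /= /fsT yT <-].
have -> : w *~ k + y = f *~ k + ((w - f) *~ k + y).
  by rewrite mulrzBl addrA addrCA subrr addr0.
exists (k, (w - f) *~ k + y) => //=.
have [_ TD _] := zspan_zsub (fs ++ T); apply: TD => //; apply: zsubMz; first exact: zspan_zsub.
by apply: zspanS Twf => u uT; rewrite mem_cat uT orbT.
Qed.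

End QuadraticGens.

(** * Absorbing the last generator for orders 3 and 4 *)

Section SmallOrderGens.
Variables (R : realType) (n' : nat).
Local Notation n := n'.+1.
Local Notation V := 'cV[R]_n.
Implicit Types (x y z u v w : V) (s T : seq V) (B M : 'M[R]_n) (L N J : set V).

Lemma mxMzE x (k : int) i j : (x *~ k) i j = x i j *~ k.
Proof. by rewrite -scaler_int mxE mulrzl. Qed.

Lemma zspan2P u v x : zspan [:: u; v] x <-> exists a b : int, x = u *~ a + v *~ b.
Proof.
split=> [/zspan_consP[a [_ [/zspan_consP[b [_ [-> ->]]] ->]]]|[a [b ->]]].
  by exists a, b; rewrite addr0.
by apply: zspan_cons; rewrite -[v *~ b]addr0; apply: zspan_cons.
Qed.

Lemma mulrz_eq0P v (k : int) : v != 0 -> v *~ k = 0 -> k = 0.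
Proof.
move=> v0 /eqP; rewrite -scaler_int scaler_eq0 (negPf v0) orbF intr_eq0.
by move/eqP.
Qed.

(** The module generated by [f] contains [T], hence also [w]; [T] then requires no generator of its
    own. *)
Lemma replace_gen L B ws T w f : is_zsub L -> {in ws, forall v, L v} -> w \in ws ->
  L `<=` zspan (ws ++ T) -> L f -> zspan T (w - f) ->
  (forall J, is_zsub J -> (forall x, J x -> J (B *m x)) -> J f -> zspan T `<=` J) ->
  exists ws', [/\ size ws' = size ws, {in ws', forall v, L v}
    & forall J, is_zsub J -> (forall x, J x -> J (B *m x)) ->
        {in ws', forall v, J v} -> L `<=` J].
Proof.
move=> Lz wsL ww Lws Lf Twf TJ.
move: ww wsL Lws => /splitPr[s1 s2] wsL Lws; exists (s1 ++ f :: s2); split.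
- by rewrite !size_cat.
- move=> x; rewrite mem_cat inE => /or3P[xs|/eqP->|xs] //; apply: wsL;
    by rewrite mem_cat inE xs ?orbT.
move=> J Jz JB sJ; have Jf : J f by apply: sJ; rewrite mem_cat mem_head orbT.
have [_ JD _] := Jz; have {}TJ := TJ J Jz JB Jf.
move=> x /Lws; apply: zspan_min => // u; rewrite -catA mem_cat /= inE mem_cat.
case/or4P => [us|/eqP->|us|us].
- by apply: sJ; rewrite mem_cat us.
- by rewrite -(subrK f w); apply: JD => //; apply: TJ.
- by apply: sJ; rewrite mem_cat inE us !orbT.
- exact/TJ/zspan_mem.
Qed.

(* The generator v is added to some member f of fs whose coefficient in x is
   prime to p; both f and v can then be recovered from t and f + v. *)
Lemma merge_gens L B t x v zs fs (p : nat) : is_zsub L -> {in zs ++ fs, forall f, L f} ->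
  L v -> prime p -> zspan fs x -> ~ (exists2 y, zspan fs y & x = y *~ p) ->
  (forall J, is_zsub J -> (forall y, J y -> J (B *m y)) ->
     {in zs ++ fs, forall f, J f} -> J v -> L `<=` J) ->
  (forall J, is_zsub J -> (forall y, J y -> J (B *m y)) ->
     J t -> {in zs, forall f, J f} -> J x) ->
  (forall J f, is_zsub J -> (forall y, J y -> J (B *m y)) ->
     f \in fs -> J (f + v) -> J (v *~ p)) ->
  exists ws, [/\ size ws = (size zs + size fs)%N, {in ws, forall v, L v}
    & forall J, is_zsub J -> (forall y, J y -> J (B *m y)) -> J t ->
        {in ws, forall v, J v} -> L `<=` J].
Proof.
move=> Lz fsL Lv pp fx xp Jgen Jx Jpv; have [_ LD _] := Lz.
have [//|[s1 [f [s2 [k [y [fsE pk sy xy]]]]]]] := zspan_dvdP p fx.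
have fsf : f \in fs by rewrite fsE mem_cat mem_head orbT.
exists (zs ++ s1 ++ (f + v) :: s2); split.
- by rewrite fsE !size_cat.
- move=> u; rewrite !mem_cat inE => /or4P[us|us|/eqP->|us].
  + by apply: fsL; rewrite mem_cat us.
  + by apply: fsL; rewrite fsE !mem_cat us orbT.
  + by apply: LD => //; apply: fsL; rewrite mem_cat fsf orbT.
  + by apply: fsL; rewrite fsE !mem_cat inE us !orbT.
move=> J Jz JB Jt sJ.
have zsJ : {in zs, forall u, J u} by move=> u us; apply: sJ; rewrite mem_cat us.
have s12J : {in s1 ++ s2, forall u, J u}.
  move=> u us; apply: sJ; rewrite !mem_cat inE.
  by move: us; rewrite mem_cat => /orP[] ->; rewrite !orbT.
have Jfv : J (f + v) by apply: sJ; rewrite !mem_cat mem_head !orbT.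
have Jkf : J (f *~ k).
  by have := zsubB Jz (Jx J Jz JB Jt zsJ) (zspan_min Jz s12J sy); rewrite xy addrK.
have [Jf Jv] := zsub_merge Jz pp pk Jkf (Jpv J f Jz JB fsf Jfv) Jfv.
apply: Jgen => // u; rewrite mem_cat => /orP[/zsJ //|].
rewrite fsE mem_cat inE => /or3P[us|/eqP-> //|us]; apply: s12J;
  by rewrite mem_cat us ?orbT.
Qed.

(** [(B - 1) w] lies in the kernel of [B^2 + B + 1], on which [B - 1] has an image of index 3; so
    [w] can be corrected to make [(B - 1) w] equal to 0, [v] or [-v]. In the last two cases it
    generates [v]. If all corrected vectors are fixed, [t] is a combination of them with a
    coefficient prime to 3, as [t = 3 z] with [z] fixed would be [z + B z + B^2 z]. *)
Lemma order3_gens L B t : is_zsub L -> separated L -> B^T *m B = 1%:M ->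
  (forall x, L x -> L (B *m x)) -> B ^+ 3 = 1 -> (exists2 x, L x & B *m x != x) ->
  L t -> B *m t = t -> (forall l, L l -> t <> l + B *m l + B *m (B *m l)) ->
  exists ws, [/\ (size ws + 2 <= n)%N, {in ws, forall v, L v}
    & forall J, is_zsub J -> (forall x, J x -> J (B *m x)) -> J t ->
        {in ws, forall v, J v} -> L `<=` J].
Proof.
move=> Lz Ls BB LB B3 [x0 Lx0 x0B] Lt Bt tN; have [L0 LD LN] := Lz.
have cube x : B *m (B *m (B *m x)) = x.
  by rewrite -[RHS]mul1mx -[1%:M]B3 !exprS expr0 mulr1 -!mulmxA.
have quad x : let y := B *m x - x in B *m (B *m y) = - (1 *: (B *m y)) - y.
  rewrite /= !mulmxBr cube; move: (B *m (B *m x)) (B *m x) => p q.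
  by apply/colP => i; rewrite !mxE; ring.
have [||[ws [wsn wsL wsJ]]|] := quad_split (e := 1) _ Lz Ls BB LB.
- by lra.
- exists (B *m x0 - x0); split; last exact: quad.
    by apply: zsubB => //; apply: LB.
  by rewrite subr_eq0.
- by exists ws; split=> // J Jz JB _; apply: wsJ.
move=> [v [ws [[Lv BBv v0 wsn wsL] [Lws LN2]]]].
move: BBv; rewrite scale1r => BBv; set b := B *m v in BBv Lws LN2.
have Lb : L b by exact: LB.
have TL : zspan [:: b; v] `<=` L.
  by apply: zspan_min => // w; rewrite !inE => /orP[]/eqP->.
have adj w : L w -> exists f (k : int), [/\ L f, zspan [:: b; v] (w - f),
    B *m f = f + v *~ k & [\/ k = 0, k = 1 | k = -1]].
  move=> Lw; have /zspan2P[a [c ac]] : zspan [:: b; v] (B *m w - w).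
    by apply: LN2; [apply: zsubB => //; apply: LB | exact: quad].
  (* [(B - 1) y = a b - (a + 3 d) v]: the coefficient of [b] is cancelled, and [d] brings
     [a + c + 3 d], that of [v], between -1 and 1. *)
  pose d := - ((a + c + 1) %/ 3)%Z.
  pose y := b *~ d + v *~ (a + 2 * d).
  have Ty : zspan [:: b; v] y by apply/zspan2P; exists d, (a + 2 * d).
  exists (w - y), (a + c + 3 * d); split.
  - by apply: zsubB => //; apply: TL.
  - by rewrite subKr.
  - have -> : B *m (w - y) = w + (b *~ a + v *~ c) - ((- b - v) *~ d + b *~ (a + 2 * d)).
      have Bw : B *m w = w + (b *~ a + v *~ c) by rewrite -ac addrC subrK.
      by rewrite mulmxBr Bw mulmxDr !mulmx_mulrz BBv.
    by apply/colP => i; rewrite !(mxE, mxMzE); ring.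
  have : -1 <= a + c + 3 * d <= 1 by rewrite /d; lia.
  by case: (a + c + 3 * d) => [[|[|//]]|[|//]] // _; [apply: Or31 | apply: Or32 | apply: Or33].
have generate J : is_zsub J -> (forall x, J x -> J (B *m x)) -> J v -> zspan [:: b; v] `<=` J.
  by move=> Jz JB Jv; apply: zspan_min => // w; rewrite !inE => /orP[]/eqP-> //; apply: JB.
have [[w ww [f [k [[Lf Twf Bf] k1]]]]|none] := pselect (exists2 w, w \in ws & exists f (k : int),
    [/\ L f, zspan [:: b; v] (w - f) & B *m f = f + v *~ k] /\ (k = 1 \/ k = -1)).
  have [|ws' [ws'n ws'L ws'J]] := @replace_gen L B ws [:: b; v] w f Lz wsL ww Lws Lf Twf.
    move=> J Jz JB Jf; apply: generate => //.
    have : J (B *m f - f) by apply: zsubB => //; apply: JB.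
    rewrite Bf addrAC subrr add0r; have [_ _ JN] := Jz.
    by case: k1 => ->; rewrite ?mulr1z // mulrNz mulr1z => /JN; rewrite opprK.
  by exists ws'; rewrite ws'n; split=> // J Jz JB _; apply: ws'J.
have [|fs [fsn fsL fsT]] := @adjust_list R n' [set f | B *m f = f] ws [:: b; v] L.
  move=> w ww; have [f [k [Lf Twf Bf [k0|k1|k1]]]] := adj w (wsL w ww).
  - by exists f; split=> //=; rewrite Bf k0 mulr0z addr0.
  - by case: none; exists w => //; exists f, k; split=> //; left.
  - by case: none; exists w => //; exists f, k; split=> //; right.
have /zspan_catP[x [y [fx Ty txy]]] := fsT _ (Lws _ Lt).
have fixed z : zspan fs z -> L z /\ B *m z = z.
  by apply: (zspan_min (zsub_fixed B Lz)) => f /fsL[Bf Lf].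
(* [y] is fixed by [B] and killed by [B^2 + B + 1], so [3 y = 0]. *)
have y0 : y = 0.
  have By : B *m y = y by move: Bt; rewrite txy mulmxDr (fixed x fx).2 => /addrI.
  have /zspan2P[a [c yac]] := Ty.
  have : B *m (B *m y) = - (B *m y) - y.
    rewrite yac !mulmxDr !mulmx_mulrz BBv mulmxBr mulmxN BBv -/b.
    by apply/colP => i; rewrite !(mxE, mxMzE); ring.
  rewrite !By => yE; apply/colP => i; have := congr1 (fun u : V => u i 0) yE.
  by rewrite !mxE; lra.
have [|||||ws' [ws'n ws'L ws'J]] :=
    @merge_gens L B t x v [::] fs 3 Lz _ Lv isT fx.
- by move=> f /fsL[].
- move=> [z fz xz]; have [Lz' Bz] := fixed z fz; case: (tN z Lz').
  by rewrite txy y0 xz !Bz; apply/colP => i; rewrite !(mxE, mxMzE); ring.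
- move=> J Jz JB fsJ Jv u /Lws/fsT; apply: zspan_min => // f.
  by rewrite mem_cat => /orP[/fsJ //|/zspan_mem]; apply: generate.
- by move=> J _ _; rewrite txy y0 addr0.
- move=> J f Jz JB /fsL[Bf _] Jfv; have [_ JD JN] := Jz.
  have Jbv : J (b - v).
    by have := zsubB Jz (JB _ Jfv) Jfv; rewrite mulmxDr Bf -/b opprD addrACA subrr add0r.
  (* On the kernel, [3 = - (B + 2) (B - 1)]. *)
  have -> : v *~ 3%N = - (B *m (b - v) + (b - v) *~ 2).
    by rewrite mulmxBr BBv -/b; apply/colP => i; rewrite !(mxE, mxMzE); ring.
  by apply/JN/JD; [apply: JB | apply: zsubMz].
by exists ws'; split=> //; rewrite ws'n fsn.
Qed.

(** [(B^2 - 1) w] lies in the kernel of [B^2 + 1], where [B^2 - 1] is multiplication by -2; so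
    correcting [w] reduces both coordinates of [(B^2 - 1) w] modulo 2. If exactly one is 1, the
    corrected vector generates [v]. Otherwise it is fixed by [B^2] or moved by [b + v], and [t] must
    have an odd coefficient along a fixed one. *)
Lemma order4_gens L B t : is_zsub L -> separated L -> B^T *m B = 1%:M ->
  (forall x, L x -> L (B *m x)) -> B ^+ 4 = 1 -> (exists2 x, L x & B *m (B *m x) != x) ->
  L t -> B *m (B *m t) = t -> (forall l, L l -> t <> l + B *m (B *m l)) ->
  exists ws, [/\ (size ws + 2 <= n)%N, {in ws, forall v, L v}
    & forall J, is_zsub J -> (forall x, J x -> J (B *m x)) -> J t ->
        {in ws, forall v, J v} -> L `<=` J].
Proof.
move=> Lz Ls BB LB B4 [x0 Lx0 x0B] Lt Bt tN; have [L0 LD LN] := Lz.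
have four x : B *m (B *m (B *m (B *m x))) = x.
  by rewrite -[RHS]mul1mx -[1%:M]B4 !exprS expr0 mulr1 -!mulmxA.
have quad x : let y := B *m (B *m x) - x in B *m (B *m y) = - (0 *: (B *m y)) - y.
  rewrite /= !mulmxBr four; move: (B *m (B *m x)) (B *m (B *m (B *m x))) => p q.
  by apply/colP => i; rewrite !mxE; ring.
have [||[ws [wsn wsL wsJ]]|] := quad_split (e := 0) _ Lz Ls BB LB.
- by rewrite expr0n.
- exists (B *m (B *m x0) - x0); split; last exact: quad.
    by apply: zsubB => //; do 2!apply: (LB).
  by rewrite subr_eq0.
- by exists ws; split=> // J Jz JB _; apply: wsJ.
move=> [v [ws [[Lv BBv v0 wsn wsL] [Lws LN2]]]].
move: BBv; rewrite scale0r oppr0 add0r => BBv; set b := B *m v in BBv Lws LN2.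
have Lb : L b by exact: LB.
have TL : zspan [:: b; v] `<=` L.
  by apply: zspan_min => // w; rewrite !inE => /orP[]/eqP->.
have BBT y : zspan [:: b; v] y -> B *m (B *m y) = - y.
  move=> /zspan2P[a [c ->]]; rewrite mulmxDr !mulmx_mulrz -/b BBv.
  rewrite mulmxDr !mulmx_mulrz mulmxN BBv -/b.
  by rewrite opprD !mulNrz.
have adj w : L w -> exists f (k l : int), [/\ L f, zspan [:: b; v] (w - f),
    B *m (B *m f) = f + (b *~ k + v *~ l) & (k = 0 \/ k = 1) /\ (l = 0 \/ l = 1)].
  move=> Lw; have /zspan2P[a [c ac]] : zspan [:: b; v] (B *m (B *m w) - w).
    by apply: LN2; [apply: zsubB => //; do 2!apply: (LB) | exact: quad].
  pose y := b *~ - (a %/ 2)%Z + v *~ - (c %/ 2)%Z.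
  have Ty : zspan [:: b; v] y by apply/zspan2P; exists (- (a %/ 2)%Z), (- (c %/ 2)%Z).
  exists (w - y), (a %% 2)%Z, (c %% 2)%Z; split.
  - by apply: zsubB => //; apply: TL.
  - by rewrite subKr.
  - have Bw : B *m (B *m w) = w + (b *~ a + v *~ c) by rewrite -ac addrC subrK.
    rewrite !mulmxBr Bw BBT // {1}(divz_eq a 2) {1}(divz_eq c 2) /y.
    by apply/colP => i; rewrite !(mxE, mxMzE); ring.
  - by split; lia.
have generate J : is_zsub J -> (forall x, J x -> J (B *m x)) -> J v -> zspan [:: b; v] `<=` J.
  by move=> Jz JB Jv; apply: zspan_min => // w; rewrite !inE => /orP[]/eqP-> //; apply: JB.
have [[w ww [f [Lf Twf Bf]]]|none] := pselect (exists2 w, w \in ws & exists f,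
    [/\ L f, zspan [:: b; v] (w - f) & B *m (B *m f) = f + b \/ B *m (B *m f) = f + v]).
  have [|ws' [ws'n ws'L ws'J]] := @replace_gen L B ws [:: b; v] w f Lz wsL ww Lws Lf Twf.
    move=> J Jz JB Jf; apply: generate => //; have [_ _ JN] := Jz.
    have : J (B *m (B *m f) - f) by apply: zsubB => //; do 2!apply: (JB).
    case: Bf => ->; rewrite addrAC subrr add0r // => /JB.
    by rewrite BBv => /JN; rewrite opprK.
  by exists ws'; rewrite ws'n; split=> // J Jz JB _; apply: ws'J.
have adj2 w : w \in ws -> exists f, [/\ L f, zspan [:: b; v] (w - f)
    & B *m (B *m f) = f \/ B *m (B *m f) = f + (b + v)].
  move=> ww; have [f [k [l [Lf Twf Bf [k01 l01]]]]] := adj w (wsL w ww).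
  exists f; split=> //; case: k01 l01 Bf => -> [] ->; rewrite ?mulr0z ?mulr1z ?addr0 ?add0r.
  - by left.
  - by move=> Bf; case: none; exists w => //; exists f; split=> //; right.
  - by move=> Bf; case: none; exists w => //; exists f; split=> //; left.
  - by right.
(* At most one generator [z] moved by [b + v] is kept: subtracting it makes the others fixed. If
   there is none, [zs] is empty and [z = 0], so that both cases continue together. *)
have [zs [z [fs [zfn zsL [Lz0 zsz Bz] fsL Lzf]]]] : exists zs z fs,
   [/\ (size zs + size fs)%N = size ws, {in zs, forall u, L u},
     [/\ L z, forall J, is_zsub J -> {in zs, forall u, J u} -> J z &
        z = 0 \/ B *m (B *m z) = z + (b + v)],
     {in fs, forall f, B *m (B *m f) = f /\ L f} &
     L `<=` zspan (fs ++ [:: z; b; v])].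
  have [[w ww [z [Lz0 Twz Bz]]]|none2] := pselect (exists2 w, w \in ws & exists f,
    [/\ L f, zspan [:: b; v] (w - f) & B *m (B *m f) = f + (b + v)]).
    move: ww wsL Lws adj2 {wsn none} => /splitPr[s1 s2] wsL Lws adj2.
    have [|fs [fsn fsL fsT]] :=
        @adjust_list R n' [set f | B *m (B *m f) = f] (s1 ++ s2) [:: z; b; v] L.
      move=> u us; have [|f [Lf Tuf [Bf|Bf]]] := adj2 u.
      - by move: us; rewrite !mem_cat inE => /orP[] ->; rewrite ?orbT.
      - by exists f; split=> //; apply: zspanW.
      exists (f - z); split.
      - by rewrite /= !mulmxBr Bf Bz opprD addrACA subrr addr0.
      - exact: zsubB.
      - by rewrite opprB addrCA addrC -[z]mulr1z addrC; apply: zspan_cons.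
    exists [:: z], z, fs; split=> //.
    - by rewrite fsn !size_cat /= add1n addnS.
    - by move=> u; rewrite inE => /eqP->.
    - by split=> //; [move=> J _; apply; rewrite mem_head | right].
    move=> x /Lws; rewrite -catA cat_cons => xs; apply: fsT.
    have [_ TD _] := zspan_zsub ((s1 ++ s2) ++ [:: z; b; v]).
    apply: zspan_min xs => [|u]; first exact: zspan_zsub.
    rewrite mem_cat inE mem_cat => /or4P[us|/eqP->|us|us].
    - by apply: zspan_mem; rewrite !mem_cat us.
    - rewrite -(subrK z w); apply: TD.
        by apply: zspanS Twz => y ys; rewrite !mem_cat inE ys !orbT.
      by apply: zspan_mem; rewrite !mem_cat mem_head !orbT.
    - by apply: zspan_mem; rewrite !mem_cat us !orbT.
    - by apply: zspan_mem; rewrite !mem_cat inE us !orbT.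
  have [|fs [fsn fsL fsT]] := @adjust_list R n' [set f | B *m (B *m f) = f] ws [:: b; v] L.
    move=> w ww; have [f [Lf Twf [Bf|Bf]]] := adj2 w ww; first by exists f.
    by case: none2; exists w => //; exists f.
  exists [::], 0, fs; split=> //.
  - by split=> // [J [] //|]; left.
  - move=> x /Lws/fsT; apply: zspanS => u; rewrite !mem_cat => /orP[-> //|us].
    by rewrite [u \in 0 :: _]in_cons us !orbT.
have /zspan_catP[x [y1 [fx /zspan_consP[c [y [Ty ->]]] txy]]] := Lzf _ Lt.
have fixed u : zspan fs u -> L u /\ B *m (B *m u) = u.
  have H : is_zsub [set u | L u /\ (B *m B) *m u = u] by exact: zsub_fixed.
  move=> /(zspan_min H) [f /fsL[Bf Lf]|Lu]; first by split=> //; rewrite -mulmxA.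
  by rewrite -mulmxA.
(* If [z] is moved by [b + v], [B^2 t = t] reads [2 y = c (b + v)], so [c] is even and [a = c / 2]
   works; if [z = 0], then [y = 0]. *)
have [a ta] : exists a : int, t = x + (z *~ a + B *m (B *m (z *~ a))).
  have := Bt; rewrite {1}txy !mulmxDr (fixed x fx).2 (BBT y Ty) !mulmx_mulrz txy => /addrI.
  case: Bz => [z0|Bz].
    rewrite z0 !mulmx0 !mul0rz !add0r => yE; exists 0; rewrite !mulr0z !mulmx0 !addr0.
    suff -> : y = 0 by rewrite addr0.
    by apply/colP => i; have := congr1 (fun u : V => u i 0) yE; rewrite !mxE; lra.
  have /zspan2P[k [l yE]] := Ty; rewrite Bz yE => E.
  have E0 : b *~ (c - 2 * k) + v *~ (c - 2 * l) = 0.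
    apply/colP => i; have := congr1 (fun u : V => u i 0) E.
    rewrite !(mxE, mxMzE) => /eqP; rewrite -subr_eq0 => /eqP Ei.
    by rewrite -[RHS]Ei; ring.
  have E1 : b *~ (c - 2 * l) = v *~ (c - 2 * k).
    have := congr1 (mulmx B) E0; rewrite mulmx0 mulmxDr !mulmx_mulrz BBv -/b mulNrz addrC.
    by move=> /eqP; rewrite subr_eq0 => /eqP.
  (* The norm of a Gaussian integer killing [v]; as [v] is nonzero, both squares vanish. *)
  have : v *~ ((c - 2 * k) ^+ 2 + (c - 2 * l) ^+ 2) = 0.
    rewrite mulrzDr !expr2 !mulrzA -E1 -!mulrzA (mulrC (c - 2 * l) (c - 2 * k)).
    by rewrite mulrzA [b *~ _]mulrzA -mulrzDl E0 mul0rz.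
  move=> /(mulrz_eq0P v0) kl; have [ck cl] : c = 2 * k /\ c = 2 * l by split; nia.
  have lk : l = k by lia.
  by exists k; rewrite !mulmx_mulrz Bz ck lk;
    apply/colP => i; rewrite !(mxE, mxMzE); ring.
have [|||||ws' [ws'n ws'L ws'J]] :=
    @merge_gens L B t x v zs fs 2 Lz _ Lv isT fx.
- by move=> f; rewrite mem_cat => /orP[/zsL //|/fsL[]].
- move=> [u fu xu]; have [Lu Bu] := fixed u fu; apply: (tN (u + z *~ a)).
    by apply: LD => //; apply: zsubMz.
  rewrite ta xu !mulmxDr Bu.
  have -> : u *~ 2%N = u + u by rewrite -pmulrn mulr2n.
  by rewrite addrACA.
- move=> J Jz JB fsJ Jv u /Lzf; apply: zspan_min => // f.
  rewrite mem_cat inE => /or3P[fs0|/eqP->|/zspan_mem]; last exact: generate.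
    by apply: fsJ; rewrite mem_cat fs0 orbT.
  by apply: zsz => // g gs; apply: fsJ; rewrite mem_cat gs.
- move=> J Jz JB Jt zsJ; have [_ JD _] := Jz.
  have -> : x = t - (z *~ a + B *m (B *m (z *~ a))) by rewrite ta addrK.
  have Jza : J (z *~ a) by apply: zsubMz => //; apply: zsz.
  by apply: zsubB => //; apply: JD => //; do 2!apply: (JB).
- move=> J f Jz JB /fsL[Bf _] Jfv; have [_ JD JN] := Jz.
  have -> : v *~ 2%N = f + v - B *m (B *m (f + v)).
    by rewrite !mulmxDr Bf -/b BBv; apply/colP => i; rewrite !(mxE, mxMzE); ring.
  by apply: zsubB => //; do 2!apply: (JB).
by exists ws'; split=> //; rewrite ws'n zfn.
Qed.

End SmallOrderGens.

(** * Crystallographic groups *)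

Section CyclicQuotients.
Variable G : groupType.
Local Open Scope group_scope.

Lemma gen_subgroup_subgroup (A : set G) : is_subgroup (gen_subgroup A).
Proof.
split=> [|x y Ax Ay|x Ax] H [Hg AH].
- by case: Hg.
- by have [_ HM _] := Hg; apply: HM; [apply: Ax | apply: Ay].
- by have [_ _ HV] := Hg; apply: HV; apply: Ax.
Qed.

Lemma subgroupX (H : set G) x k : is_subgroup H -> H x -> H (x ^+ k).
Proof.
case=> H1 HM _ Hx; elim: k => [|k IHk]; first by rewrite expg0.
by rewrite expgS; apply: HM.
Qed.

Lemma min_num_gens_le (H : set G) k : generated_by H k ->
  exists2 d, min_num_gens H d & (d <= k)%N.
Proof.
move=> Hk; have exk : exists k, `[< generated_by H k >] by exists k; apply/asboolP.
have [d /asboolP Hd dmin] := ex_minnP exk; exists d; last exact/dmin/asboolP.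
by split=> // l Hl; apply/dmin/asboolP.
Qed.

Lemma cyclic_quotient (H N : set G) m : is_subgroup H -> is_subgroup N -> N `<=` H ->
  (1 < m)%N -> quotient_isom H N 'Z_m ->
  exists a, [/\ H a, N (a ^+ m), forall k, (0 < k < m)%N -> ~ N (a ^+ k)
    & forall g, H g -> exists k t, [/\ (k < m)%N, N t & g = a ^+ k * t]].
Proof.
move=> [H1 HM HV] [N1 NM NV] NH m1 [f [finj frange fM]].
have fcoset z : exists2 h, H h & f z = prod_set [set h] N.
  have : range f (f z) by exists z.
  by rewrite frange => -[h Hh <-]; exists h.
have cosetP (h g : G) : prod_set [set h] N g <-> exists2 t, N t & g = h * t.
  split=> [[_ -> [t Nt <-]]|[t Nt ->]]; first by exists t.
  by exists h => //; exists t.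
have coset_self h : prod_set [set h] N h.
  by apply/cosetP; exists 1; rewrite ?mulg1.
have f1 : f 1 = N.
  have [h _ fh] := fcoset 1.
  have Nh : N h.
    (* The coset [f 1] is idempotent, so [h * h] lies in the coset of [h]; cancelling [h] puts it in
       [N]. *)
    have : f (1 * 1) (h * h).
      by rewrite fM fh; exists h; [exact: coset_self | exists h].
    by rewrite mulg1 fh => /cosetP[t Nt /mulgI->].
  rewrite fh; apply/seteqP; split=> g; first by move=> /cosetP[t Nt ->]; apply: NM.
  by move=> Ng; apply/cosetP; exists (h^-1 * g); rewrite ?mulVKg //; apply: NM => //; apply: NV.
pose gen : 'Z_m := 1%R.
have [a Ha fa] := fcoset gen.
have aX k : f (gen ^+ k) (a ^+ k).
  elim: k => [|k IHk]; first by rewrite !expg0 f1.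
  rewrite !expgSr fM; exists (a ^+ k) => //; exists a => //.
  by rewrite fa.
(* The group law of ['Z_m] is addition: [1] is the residue 0, and a power of [gen] is a multiple of
   the residue 1. *)
have genX k : gen ^+ k = inZp k :> 'Z_m.
  by rewrite /gen; apply/val_inj; rewrite [LHS]/= Zp_expg /= modnMml ?mul1n.
have fN z g : N g -> f z g -> z = 1.
  move=> Ng; have [h _ fh] := fcoset z; rewrite fh => /cosetP[t Nt gE].
  have Nh : N h by rewrite -(mulgK t h) -gE; apply: NM => //; apply: NV.
  apply: finj; rewrite f1 fh; apply/seteqP; split=> x.
    by move=> /cosetP[u Nu ->]; apply: NM.
  by move=> Nx; apply/cosetP; exists (h^-1 * x); rewrite ?mulVKg //; apply: NM => //; apply: NV.
exists a; split=> //.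
- have := aX m; rewrite genX; suff -> : inZp m = 1 :> 'Z_m by rewrite f1.
  by apply/val_inj; rewrite /= Zp_cast // modnn.
- move=> k /andP[k0 km] /(fN (gen ^+ k)) /(_ (aX k)); rewrite genX => /(congr1 val) /=.
  by rewrite Zp_cast // modn_small // => k00; rewrite k00 in k0.
- move=> g Hg; have : cosets H N (prod_set [set g] N) by exists g.
  rewrite -frange => -[z _ fz].
  have zE : z = gen ^+ (val z) by rewrite genX valZpK.
  have := aX (val z); rewrite -zE fz => /cosetP[t Nt aE].
  exists (val z), t^-1; split; first by apply: leq_trans (ltn_ord z) _; rewrite Zp_cast.
    exact: NV.
  by rewrite aE mulgK.
Qed.

End CyclicQuotients.

(** * The lattice of translations and its holonomy action *)

Section TranslationLattice.
Variables (R : realType) (n : nat).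
Local Notation V := 'cV[R]_n.
Local Notation E := (eisometry R n).
Implicit Types (g h : E) (x y : V) (Gamma : set E).

Lemma linpartM g h : linpart (g * h)%g = linpart g *m linpart h. Proof. by []. Qed.
Lemma translM g h : transl (g * h)%g = transl g + linpart g *m transl h. Proof. by []. Qed.
Lemma linpartV g : linpart g^-1%g = (linpart g)^T. Proof. by []. Qed.
Lemma translV g : transl g^-1%g = - ((linpart g)^T *m transl g). Proof. by []. Qed.

Lemma linpartX g k : linpart (g ^+ k)%g = linpart g ^+ k.
Proof. by elim: k => [|k IHk]; rewrite ?expg0 ?expgS ?linpartM ?IHk ?exprS. Qed.

Lemma linpart_trmx g : linpart g *m (linpart g)^T = 1%:M.
Proof. exact: mulmx1C (linpartP g). Qed.

Lemma eisometry_eq g h : linpart g = linpart h -> transl g = transl h -> g = h.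
Proof.
move=> gh1 gh2; apply/val_inj; move: gh1 gh2; rewrite /linpart /transl.
by case: (val g) (val h) => [? ?] [? ?] /= -> ->.
Qed.

Fact transl_isom_subproof x : is_eisometry (x, 1%:M).
Proof. by rewrite /is_eisometry /= trmx1 mulmx1. Qed.

Definition transl_isom x : E := EIsometry (transl_isom_subproof x).

Lemma linpart_transl x : linpart (transl_isom x) = 1%:M. Proof. by []. Qed.
Lemma transl_transl x : transl (transl_isom x) = x. Proof. by []. Qed.

Lemma transl_isomE g : linpart g = 1%:M -> g = transl_isom (transl g).
Proof. by move=> g1; apply: eisometry_eq. Qed.

Lemma transl_isomD x y : transl_isom (x + y) = (transl_isom x * transl_isom y)%g.
Proof. by apply: eisometry_eq; rewrite ?linpartM ?translM ?mul1mx ?mulmx1. Qed.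

Lemma transl_isomN x : transl_isom (- x) = (transl_isom x)^-1%g.
Proof. by apply: eisometry_eq; rewrite ?linpartV ?translV /= trmx1 ?mul1mx. Qed.

Lemma transl_isom0 : transl_isom 0 = 1%g.
Proof. exact: eisometry_eq. Qed.

Lemma transl_isomJ g x : transl_isom (linpart g *m x) = (g * transl_isom x * g^-1)%g.
Proof.
apply: eisometry_eq; rewrite ?translM !linpartM linpart_transl mulmx1.
  by rewrite linpartV linpart_trmx.
by rewrite translV transl_transl mulmxN mulmxA linpart_trmx mul1mx addrAC subrr add0r.
Qed.

Definition translattice Gamma : set V := [set x | Gamma (transl_isom x)].

Lemma translationsE Gamma g : translations Gamma g <->
  exists2 x, translattice Gamma x & g = transl_isom x.
Proof.
split=> [[Gg g1]|[x Lx ->]]; last by [].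
by exists (transl g); [rewrite /translattice /= -transl_isomE | exact: transl_isomE].
Qed.

Lemma translattice_zsub Gamma : is_subgroup Gamma -> is_zsub (translattice Gamma).
Proof.
case=> G1 GM GV; split; rewrite /translattice /=.
- by rewrite transl_isom0.
- by move=> x y Gx Gy; rewrite transl_isomD; apply: GM.
- by move=> x Gx; rewrite transl_isomN; apply: GV.
Qed.

Lemma translattice_stable Gamma g x : is_subgroup Gamma -> Gamma g ->
  translattice Gamma x -> translattice Gamma (linpart g *m x).
Proof.
case=> G1 GM GV Gg Lx; rewrite /translattice /= transl_isomJ.
by apply: (GM); [apply: GM | apply: GV].
Qed.

Lemma translations_subgroup Gamma : is_subgroup Gamma -> is_subgroup (translations Gamma).
Proof.
case=> G1 GM GV; split=> [|x y [Gx x1] [Gy y1]|x [Gx x1]]; split=> //=.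
- exact: GM.
- by rewrite linpartM x1 y1 mulmx1.
- exact: GV.
- by rewrite linpartV x1 trmx1.
Qed.

(** A neighbourhood of the identity meets [Gamma] there only. The topology being that of pairs of a
    vector and a matrix, it contains the translations by all vectors with coordinates below some
    [e]. *)
Lemma translattice_separated Gamma : is_subgroup Gamma -> discrete Gamma ->
  separated (translattice Gamma).
Proof.
move=> [G1 _ _] /(_ _ G1)[_ [U]].
rewrite nbhsE => -[W [[A Aop AW] W1] WU] UG.
have : nbhs (val (1%g : E)) A by apply: open_nbhs_nbhs; split=> //; rewrite -AW in W1.
move=> [[A1 A2] /= [/nbhs_ballP[e /= e0 eA1] nA2] A12].
exists e => // x Lx; apply: contraNP => /forallNP xe; apply/eqP.
have : (U `&` Gamma) (transl_isom x).
  split=> //; apply: WU; rewrite -AW; apply: A12; split=> /=; last exact: nbhs_singleton nA2.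
  apply: eA1; split=> // i j; rewrite /ball /= (ord1 j) mxE sub0r normrN ltNge.
  exact/negP/xe.
by rewrite UG => /(congr1 (@transl R n)).
Qed.

End TranslationLattice.

Section CrystallographicGroups.
Variables (R : realType) (n : nat).
Local Notation V := 'cV[R]_n.
Local Notation E := (eisometry R n).
Implicit Types (g h a : E) (x y : V) (Gamma : set E).
Local Notation translattice := (@translattice R n).

Lemma compact_sqn_bounded (K : set V) : compact K -> exists c : R, forall x, K x -> sqn x <= c.
Proof.
move=> Kc.
have coord i : exists c : R, forall x, K x -> `|x i 0| <= c.
  have : compact ((fun x : V => x i 0) @` K).
    by apply: continuous_compact => //; apply: continuous_subspaceT; exact: coord_continuous.
  move=> /compact_bounded[M [_ MK]]; exists (M + 1) => x Kx.
  by apply: (MK (M + 1)); [rewrite ltrDl | exists x].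
have [c cP] := choice coord.
exists (\sum_i c i ^+ 2) => x Kx; apply: ler_sum => i _.
by rewrite -expr2 -real_normK ?num_real // ler_sqr ?nnegrE ?cP // (le_trans _ (cP i x Kx)).
Qed.

Lemma sqnD_le x y : sqn (x + y) <= 2 * sqn x + 2 * sqn y.
Proof.
rewrite -[y in leLHS]scale1r sqnDZ; have := sqn_ge0 (x + (-1) *: y).
by rewrite sqnDZ; lra.
Qed.

(* Modulo the lattice the orbits of Gamma meet a bounded set, so B - 1 would be a
   bounded linear map if B fixed the lattice pointwise. *)
Lemma translattice_faithful Gamma a m (B : 'M[R]_n) : cocompact Gamma ->
  (forall g, Gamma g -> exists k t, [/\ (k < m)%N, translations Gamma t & g = (a ^+ k * t)%g]) ->
  is_subgroup Gamma -> Gamma a -> B^T *m B = 1%:M -> B != 1%:M ->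
  exists2 x, translattice Gamma x & B *m x != x.
Proof.
move=> [K [Kc KT]] coset Gs Ga BB B1; apply: contrapT => noex.
have fixed x : translattice Gamma x -> B *m x = x.
  by move=> Lx; apply/eqP; apply: contrapT => /negP Bx; apply: noex; exists x.
have [c cK] := compact_sqn_bounded Kc.
pose D := \sum_(k < m) sqn (transl (a ^+ k)%g).
have bound y : sqn (B *m y - y) <= 8 * (c + D).
  have : [set: V] y by [].
  rewrite -KT => -[g /coset[k [t [km /translationsE[x Lx ->] ->]]] [z Kz <-]].
  pose A := linpart (a ^+ k)%g; pose u := A *m z + transl (a ^+ k)%g.
  have -> : iact (a ^+ k * transl_isom x)%g z = A *m x + u.
    by rewrite iactM /iact linpart_transl transl_transl mul1mx mulmxDr /u addrCA addrA.
  have AL : translattice Gamma (A *m x) by apply: translattice_stable => //; apply: subgroupX.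
  have -> : B *m (A *m x + u) - (A *m x + u) = B *m u - u.
    by rewrite mulmxDr (fixed _ AL) opprD addrACA subrr add0r.
  have uD : sqn u <= 2 * (c + D).
    apply: le_trans (sqnD_le _ _) _; rewrite mulrDr; apply: lerD; rewrite ler_pM2l //.
      by rewrite [sqn _]dot_isom ?linpartP //; apply: cK.
    rewrite /D (bigD1 (Ordinal km)) //= lerDl; apply: sumr_ge0 => i _; exact: sqn_ge0.
  apply: le_trans (sqnD_le _ _) _; rewrite sqnN [sqn (B *m u)]dot_isom // -/(sqn u).
  by lra.
case/negP: B1; apply/eqP.
have By y : B *m y = y.
  apply/eqP; rewrite -subr_eq0 -sqn_eq0; apply: contrapT => /negP q0.
  have {}q0 : 0 < sqn (B *m y - y) by rewrite lt_def q0 sqn_ge0.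
  set q := sqn _ in q0.
  have scaled (r : R) : r ^+ 2 * q <= 8 * (c + D).
    have := bound (r *: y); rewrite -scalemxAr -scalerBr.
    by rewrite /sqn dotZl dotZr mulrA -expr2.
  have C0 : 0 <= 8 * (c + D) by have := scaled 0; rewrite expr0n mul0r.
  (* With [w = 8 (c + D) / q], this scale would force [(w + 1)^2 <= w]. *)
  have := scaled (8 * (c + D) / q + 1).
  set w := 8 * (c + D) / q; have w0 : 0 <= w by apply: divr_ge0 => //; exact: ltW.
  have -> : 8 * (c + D) = w * q by rewrite divfK // lt0r_neq0.
  by rewrite ler_pM2r //; nra.
apply/matrixP => i j; have := By (delta_mx j 0) => /(congr1 (fun u : V => u i 0)).
by rewrite -colE !mxE eqxx andbT.
Qed.

Lemma translX g l : transl (g ^+ l)%g = (\sum_(i < l) linpart g ^+ i) *m transl g.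
Proof.
elim: l => [|l IHl]; first by rewrite expg0 big_ord0 mul0mx.
by rewrite expgSr translM IHl linpartX big_ord_recr mulmxDl.
Qed.

(** The vectors whose translations lie in the generated subgroup form a subgroup, stable under
    [linpart a] through conjugation by [a], that contains the vector of [a ^+ m]; it is therefore
    the whole lattice. *)
Lemma generated_by_lattice Gamma a m (ws : seq V) : is_subgroup Gamma -> Gamma a ->
  (forall g, Gamma g -> exists k t, [/\ (k < m)%N, translations Gamma t & g = (a ^+ k * t)%g]) ->
  translations Gamma (a ^+ m)%g ->
  {in ws, forall w, translattice Gamma w} ->
  (forall J : set V, is_zsub J -> (forall x, J x -> J (linpart a *m x)) ->
     J (transl (a ^+ m)%g) -> {in ws, forall w, J w} -> translattice Gamma `<=` J) ->
  generated_by Gamma (size ws).+1.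
Proof.
move=> Gs Ga coset [_ am] wsL Lgen.
have sz : size (a :: [seq transl_isom w | w <- ws]) == (size ws).+1 by rewrite /= size_map.
exists (Tuple sz).
set S := [set` _]; have Sg := gen_subgroup_subgroup S.
have SH : S `<=` gen_subgroup S by move=> x Sx H [_]; apply.
have Smem g : g \in a :: [seq transl_isom w | w <- ws] -> S g by [].
apply/seteqP; split.
  move=> x; apply; split=> // g Sg'.
  have : g \in a :: [seq transl_isom w | w <- ws] by exact: Sg'.
  rewrite inE => /predU1P[-> //|/mapP[w ww ->]]; exact: wsL.
pose J := [set x | gen_subgroup S (transl_isom x)].
have [S1 SM SV] := Sg.
have Sa : gen_subgroup S a by exact: (SH _ (Smem _ (mem_head _ _))).
have LJ : translattice Gamma `<=` J.
  apply: Lgen.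
  - split; rewrite /J /=; first by rewrite transl_isom0.
      by move=> x y Gx Gy; rewrite transl_isomD; apply: SM.
    by move=> x Gx; rewrite transl_isomN; apply: SV.
  - by move=> x Jx; rewrite /J /= transl_isomJ; apply: (SM); [apply: SM | apply: SV].
  - by rewrite /J /= -transl_isomE //; exact: (subgroupX m Sg Sa).
  - by move=> w ww; apply: (SH _ (Smem _ _)); rewrite inE map_f ?orbT.
move=> g /coset[k [t [_ /translationsE[x Lx ->] ->]]].
exact: (SM _ _ (subgroupX k Sg Sa) (LJ x Lx)).
Qed.

End CrystallographicGroups.

(** As 4 does not divide [m], the odd part [k] is [m] or its half, and exceeds 1; its smallest prime
    factor is neither 2 nor 3. *)
Lemma not3smooth m : (3 <= m)%N -> ~~ (3 %| m)%N -> ~~ (4 %| m)%N ->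
  exists p : nat, [/\ prime p, (p %| m)%N & (3 < p)%N].
Proof.
move=> m3 n3 n4.
pose k := if odd m then m else m./2.
have km : (k %| m)%N.
  rewrite /k; case: ifP => // /negbT; rewrite -dvdn2 => /dvdnP[q ->].
  by rewrite muln2 doubleK -muln2 dvdn_mulr.
have k1 : (1 < k)%N by rewrite /k; case: ifP => // _; lia.
have ko : odd k.
  rewrite /k; case: ifP => // /negbT; rewrite -dvdn2 => /dvdnP[q mE]; move: n4.
  by rewrite mE muln2 doubleK; apply: contraR; rewrite -dvdn2 => /dvdnP[r ->]; lia.
exists (pdiv k); have pp := pdiv_prime k1; have pk := pdiv_dvd k; have pm := dvdn_trans pk km.
have p1 := prime_gt1 pp; split=> //; rewrite ltnNge; apply/negP => p3.
have p2 : pdiv k != 2%N.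
  by apply: contraTneq ko => p2; rewrite -dvdn2; move: pk; rewrite p2.
have p3' : pdiv k != 3%N by apply: contraNneq n3 => <-.
by lia.
Qed.

Theorem theoremA (R : realType) (n m : nat) (Gamma : set (eisometry R n)) :
  crystallographic Gamma -> (3 <= m)%N -> holonomy_cyclic Gamma m ->
  ((exists p : nat, [/\ prime p, (p %| m)%N & (3 < p)%N]) ->
     exists2 d : nat, min_num_gens Gamma d & (d + 2 <= n)%N)
  /\
  (~ (exists p : nat, [/\ prime p, (p %| m)%N & (3 < p)%N]) ->
     torsion_free Gamma ->
     exists2 d : nat, min_num_gens Gamma d & (d + 1 <= n)%N).
Proof.
move=> [Gs Gd Gc] m3 Gm.
have [||a [Ga Tam Tak coset]] := cyclic_quotient Gs (translations_subgroup Gs) _ _ Gm.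
- by move=> g [].
- exact: ltnW.
case: n Gamma Gs Gd Gc {Gm} a Ga Tam Tak coset => [|n] Gamma Gs Gd Gc a Ga Tam Tak coset.
  (* In dimension 0 all matrices coincide, so [a] itself would be a translation. *)
  by case: (Tak 1%N); [lia | split=> //; apply/matrixP => -[]].
set A := linpart a; pose L := translattice Gamma; pose t := transl (a ^+ m)%g.
have Lz : is_zsub L by exact: translattice_zsub.
have Ls : separated L by exact: translattice_separated.
have LA k x : L x -> L (A ^+ k *m x).
  by move=> Lx; rewrite -linpartX; apply: translattice_stable => //; apply: subgroupX.
have Am : A ^+ m = 1 by rewrite -linpartX; case: Tam.
have Aorth k : (A ^+ k)^T *m A ^+ k = 1%:M by rewrite -linpartX linpartP.
have faithful k : (0 < k < m)%N -> exists2 x, L x & A ^+ k *m x != x.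
  move=> km; apply: (translattice_faithful Gc coset) => //.
  apply/eqP => Ak1; apply: (Tak k km); split; first exact: subgroupX.
  by rewrite /= linpartX.
have Lt : L t by rewrite /L /translattice /= -transl_isomE; case: Tam.
(* [a] commutes with [a ^+ m]; the translation parts of the two products are compared. *)
have At k : A ^+ k *m t = t.
  elim: k => [|k IHk]; first by rewrite expr0 mul1mx.
  rewrite exprSr -mulmxA -[RHS]IHk; congr (_ *m _).
  have : transl (a * a ^+ m)%g = transl (a ^+ m * a)%g by rewrite -expgS -expgSr.
  by rewrite !translM [linpart (a ^+ m)%g]linpartX -/A Am mul1mx addrC => /addIr.
(* Subgroups stable under [A] are stable under [A ^+ k], so generators for the latter suffice; the
   successor in [c.+1] pays for the generator [a]. *)
have finish k c (ws : seq 'cV[R]_n.+1) : (size ws + c.+1 <= n.+1)%N ->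
    {in ws, forall w, L w} ->
    (forall J, is_zsub J -> (forall x, J x -> J (A ^+ k *m x)) -> J t ->
      {in ws, forall w, J w} -> L `<=` J) ->
    exists2 d, min_num_gens Gamma d & (d + c <= n.+1)%N.
  move=> wsn wsL wsJ.
  have [|d Gamma_d dn] := @min_num_gens_le _ Gamma (size ws).+1.
    apply: (generated_by_lattice Gs Ga coset Tam wsL) => J Jz JA.
    by apply: wsJ => // x; apply: stable_exp.
  by exists d => //; apply: leq_trans wsn; rewrite addnS -addSn leq_add2r.
have divm k : (1 < k)%N -> (k %| m)%N -> (0 < m %/ k < m)%N.
  move=> k1 /dvdn_leq km; rewrite divn_gt0 ?km ?ltn_Pdiv //; lia.
(* If [t] were this sum, translating [a ^+ k] by [-x] would give an element [g] with [g ^+ l = 1],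
   nontrivial since its linear part is that of [a ^+ k]. *)
have torsion k l x : torsion_free Gamma -> (k * l)%N = m -> (0 < k < m)%N -> L x ->
    t <> (\sum_(i < l) (A ^+ k) ^+ i) *m x.
  move=> Gtf klm km Lx tE; have [_ GM _] := Gs.
  have l0 : (0 < l)%N by case: l klm {tE} => // klm; move: km; rewrite -klm muln0 andbF.
  pose g := (transl_isom (- x) * a ^+ k)%g.
  have gA : linpart g = A ^+ k by rewrite linpartM linpart_transl mul1mx linpartX.
  have gX : (g ^+ l = 1)%g.
    apply: eisometry_eq; first by rewrite linpartX gA -exprM klm Am.
    rewrite translX gA translM linpart_transl transl_transl mul1mx mulmxDr mulmxN -tE.
    by rewrite /t -klm expgnA translX linpartX addNr.
  have Gg : Gamma g.
    apply: GM; last exact: subgroupX.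
    by have [_ _ LN] := Lz; apply: LN.
  have g1 := Gtf g l Gg l0 gX; apply: (Tak k km); split; first exact: subgroupX.
  by rewrite /= linpartX -/A -gA g1.
split=> [[p [pp pm p3]]|no_p Gtf].
  have km := divm p (prime_gt1 pp) pm.
  have Bp : (A ^+ (m %/ p)) ^+ p = 1 by rewrite -exprM divnK.
  have [ws [wsn wsL wsJ]] := prime_gens Lz Ls (Aorth _) (LA _) pp p3 Bp (faithful _ km).
  by apply: (finish (m %/ p)%N 2 ws) => // J Jz JB _; apply: wsJ.
have [m3'|n3] := boolP (3 %| m)%N.
  have km := divm 3 isT m3'.
  have B3 : (A ^+ (m %/ 3)) ^+ 3 = 1 by rewrite -exprM divnK.
  have [|ws [wsn wsL wsJ]] :=
      order3_gens Lz Ls (Aorth _) (LA _) B3 (faithful _ km) Lt (At _).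
    move=> x Lx; have := torsion _ 3 x Gtf (divnK m3') km Lx.
    by rewrite !big_ord_recl big_ord0 addr0 !mulmxDl expr0 mul1mx expr1 addrA -mulmxA.
  exact: (finish (m %/ 3)%N 1%N ws).
have [m4|n4] := boolP (4 %| m)%N; last by case: no_p; exact: not3smooth.
(* [B = A ^+ (m %/ 4)] enters the conditions through its square [A ^+ (m %/ 2)], so faithfulness and
   torsion-freeness are applied with exponent [m %/ 2]. *)
have m2 : (2 %| m)%N := dvdn_trans (isT : (2 %| 4)%N) m4.
have km := divm 2 isT m2.
have B4 : (A ^+ (m %/ 4)) ^+ 4 = 1 by rewrite -exprM divnK.
have B2 x : A ^+ (m %/ 4) *m (A ^+ (m %/ 4) *m x) = A ^+ (m %/ 2) *m x.
  by rewrite mulmxA -[X in X *m _]exprD; congr (A ^+ _ *m _); move/dvdnP: m4 => [q ->]; lia.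
have [|||ws [wsn wsL wsJ]] := order4_gens Lz Ls (Aorth _) (LA _) B4 _ Lt _.
- by have [x Lx Bx] := faithful _ km; exists x; rewrite // B2.
- by rewrite B2.
- move=> x Lx; rewrite B2; have := torsion _ 2 x Gtf (divnK m2) km Lx.
  by rewrite !big_ord_recl big_ord0 addr0 mulmxDl expr0 mul1mx.
exact: (finish (m %/ 4)%N 1%N ws).
Qed.
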